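(* Let $\mathcal{C},\mathcal{D},\mathcal{I}$ be 2-categories, let $\mathcal{A}$ be either $\mathcal{H}om(\mathcal{C},\mathcal{D})$ or $\mathcal{H}om_p(\mathcal{C},\mathcal{D})$, and let $F:\mathcal{I}\to\mathcal{A}$, $i\mapsto F_i$, be a 2-functor. For each $C\in\mathcal{C}$ let $\lambda^C_i:F_iC\to LC$ ($i\in\mathcal{I}$) be a pseudocolimit pseudocone in $\mathcal{D}$ for the 2-functor $\mathcal{I}\xrightarrow{F}\mathcal{A}\xrightarrow{ev(-,C)}\mathcal{D}$, where $ev(-,C)$ is evaluation at $C$. Then $LC$ is 2-functorial in $C$ in such a way that each $\lambda_i$ (with components $\lambda_i^C$) becomes a 2-natural transformation $F_i\Rightarrow L$, and $\lambda_i:F_i\Rightarrow L$ is a pseudocolimit pseudocone for $F$ in $\mathcal{A}$, in both cases. By duality the same assertion holds for pseudolimits.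
   Context: 2-categories, 2-functors and 2-natural transformations are strict ($\mathcal{C}at$-enriched). ''$\circ$'' denotes vertical composition, juxtaposition horizontal composition (and whiskering). A pseudonatural transformation $\theta:F\Rightarrow G$ between 2-functors $\mathcal{C}\to\mathcal{D}$ consists of arrows $\theta_C:FC\to GC$ and invertible 2-cells $\theta_f:Gf\,\theta_C\Rightarrow\theta_D\,Ff$ for $f:C\to D$, such that $\theta_{id_C}=id_{\theta_C}$; $\theta_g Ff\circ Gg\,\theta_f=\theta_{gf}$ for $C\xrightarrow{f}D\xrightarrow{g}E$; and $\theta_g\circ G\alpha\,\theta_C=\theta_D F\alpha\circ\theta_f$ for $\alpha:f\Rightarrow g:C\to D$. It is 2-natural if all $\theta_f$ are identities. A modification $\rho:\theta\to\eta$ between pseudonatural transformations is a family of 2-cells $\rho_C:\theta_C\Rightarrow\eta_C$ with $\rho_D Ff\circ\theta_f=\eta_f\circ Gf\rho_C$ for all $f:C\to D$. $\mathcal{H}om(\mathcal{C},\mathcal{D})$ (resp. $\mathcal{H}om_p(\mathcal{C},\mathcal{D})$) is the 2-category of 2-functors $\mathcal{C}\to\mathcal{D}$, 2-natural (resp. pseudonatural) transformations, and modifications, with componentwise compositions. Pseudocones and pseudocolimits: for a 2-functor $F:\mathcal{I}\to\mathcal{A}$, a pseudocone with vertex $A$ is a pseudonatural transformation from $F$ to the 2-functor constant at $A$, i.e. arrows $\theta_i:Fi\to A$ and invertible 2-cells $\theta_u:\theta_i\Rightarrow\theta_jFu$ for $u:i\to j$ with $\theta_{id_i}=id$, $\theta_vFu\circ\theta_u=\theta_{vu}$,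 and $\theta_v=\theta_jF\alpha\circ\theta_u$ for $\alpha:u\Rightarrow v$; morphisms of pseudocones are modifications. A pseudocolimit pseudocone $\lambda_i:Fi\to L$ is one such that pre-composition with $\lambda$ is an isomorphism of categories from $\mathcal{A}(L,A)$ to the category of pseudocones for $F$ with vertex $A$, for every $A\in\mathcal{A}$. Pseudolimits (of 2-functors $\mathcal{I}^{op}\to\mathcal{A}$) are the dual notion. *)

(* Defs.v *)
From Stdlib Require Import ClassicalEpsilon FunctionalExtensionality ProofIrrelevance.

Set Implicit Arguments.
Unset Strict Implicit.
Unset Printing Implicit Defensive.

(* A category is given by a type of objects and ONE type of arrows with domain
   and codomain maps; [cmp g f] ("g after f") takes a proof of composability.
   Since arrows are not indexed by their endpoints, the strict associativity and
   unit laws of a 2-category can be stated as plain equations, without transport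
   along equalities of 1-cells.

   Convention: when a law involves composites, the composability proofs it
   mentions are universally quantified.  They are always derivable from the
   other laws and irrelevant (proof irrelevance), so no law is vacuous. *)

Record Cat : Type := {
  ob :> Type;
  mor : Type;
  dom : mor -> ob;
  cod : mor -> ob;
  idm : ob -> mor;
  cmp : forall g f : mor, dom g = cod f -> mor;
  dom_idm : forall x, dom (idm x) = x;
  cod_idm : forall x, cod (idm x) = x;
  dom_cmp : forall g f e, dom (@cmp g f e) = dom f;
  cod_cmp : forall g f e, cod (@cmp g f e) = cod g;
  cmp_idl : forall f e, @cmp (idm (cod f)) f e = f;
  cmp_idr : forall f e, @cmp f (idm (dom f)) e = f;
  cmp_assoc : forall h g f e1 e2 e3 e4,
    @cmp h (@cmp g f e1) e2 = @cmp (@cmp h g e3) f e4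
}.

Arguments mor : clear implicits.
Arguments idm {c} x.
Arguments dom {c} _.
Arguments cod {c} _.
Arguments cmp {c} g f _.

Definition invertible {X : Cat} (a : mor X) : Prop :=
  exists (b : mor X) (e1 : dom b = cod a) (e2 : dom a = cod b),
    cmp b a e1 = idm (dom a) /\ cmp a b e2 = idm (cod a).

Record Functor (X Y : Cat) : Type := {
  fob :> X -> Y;
  fmor : mor X -> mor Y;
  fdom : forall a, dom (fmor a) = fob (dom a);
  fcod : forall a, cod (fmor a) = fob (cod a);
  fidm : forall x, fmor (idm x) = idm (fob x);
  fcmp : forall b a e e', fmor (cmp b a e) = cmp (fmor b) (fmor a) e'
}.

Definition IsIsoCat {X Y : Cat} (F : Functor X Y) : Prop :=
  exists G : Functor Y X,
    (forall x, G (F x) = x) /\ (forall a, fmor G (fmor F a) = a) /\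
    (forall y, F (G y) = y) /\ (forall b, fmor F (fmor G b) = b).

Record TwoCat : Type := {
  Ob :> Type;
  Hom : Ob -> Ob -> Cat;
  id1 : forall A, Hom A A;
  comp1 : forall A B C, Hom B C -> Hom A B -> Hom A C;
  comp2 : forall A B C, mor (Hom B C) -> mor (Hom A B) -> mor (Hom A C);
  dom_comp2 : forall A B C (b : mor (Hom B C)) (a : mor (Hom A B)),
    dom (comp2 b a) = comp1 (dom b) (dom a);
  cod_comp2 : forall A B C (b : mor (Hom B C)) (a : mor (Hom A B)),
    cod (comp2 b a) = comp1 (cod b) (cod a);
  comp2_idm : forall A B C (g : Hom B C) (f : Hom A B),
    comp2 (idm g) (idm f) = idm (comp1 g f);
  comp2_cmp : forall A B C (b' b : mor (Hom B C)) (a' a : mor (Hom A B)) e1 e2 e3,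
    comp2 (cmp b' b e1) (cmp a' a e2) = cmp (comp2 b' a') (comp2 b a) e3;
  comp1_idl : forall A B (f : Hom A B), comp1 (id1 B) f = f;
  comp1_idr : forall A B (f : Hom A B), comp1 f (id1 A) = f;
  comp1_assoc : forall A B C D (h : Hom C D) (g : Hom B C) (f : Hom A B),
    comp1 h (comp1 g f) = comp1 (comp1 h g) f;
  comp2_idl : forall A B (a : mor (Hom A B)), comp2 (idm (id1 B)) a = a;
  comp2_idr : forall A B (a : mor (Hom A B)), comp2 a (idm (id1 A)) = a;
  comp2_assoc : forall A B C D (c : mor (Hom C D)) (b : mor (Hom B C)) (a : mor (Hom A B)),
    comp2 c (comp2 b a) = comp2 (comp2 c b) a
}.

Arguments Hom {t} A B.
Arguments id1 {t} A.
Arguments comp1 {t A B C} g f.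
Arguments comp2 {t A B C} b a.

Notation "g · f" := (comp1 g f) (at level 40, left associativity).
Notation "b ⋆ a" := (comp2 b a) (at level 40, left associativity).
Notation "g ◁ a" := (comp2 (idm g) a) (at level 40, left associativity).
Notation "a ▷ f" := (comp2 a (idm f)) (at level 40, left associativity).

(* The structure making a given object map into a 2-functor is kept separate
   from the object map, so that one can say "L C is 2-functorial in C". *)
Record TwoFunctorStr {C D : TwoCat} (F0 : C -> D) : Type := {
  fmap : forall X Y : C, Functor (Hom X Y) (Hom (F0 X) (F0 Y));
  fmap_id1 : forall X, fmap X X (id1 X) = id1 (F0 X);
  fmap_comp1 : forall X Y Z (g : Hom Y Z) (f : Hom X Y),
    fmap X Z (g · f) = fmap Y Z g · fmap X Y f;
  fmap_comp2 : forall X Y Z (b : mor (Hom Y Z)) (a : mor (Hom X Y)),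
    fmor (fmap X Z) (b ⋆ a) = fmor (fmap Y Z) b ⋆ fmor (fmap X Y) a
}.

Record TwoFunctor (C D : TwoCat) : Type := MkTwoFunctor {
  tob :> C -> D;
  tstr : TwoFunctorStr tob
}.
Arguments MkTwoFunctor {C D} tob tstr.

Notation map1 F f := (fob (fmap (tstr F) _ _) f).
Notation map2 F a := (fmor (fmap (tstr F) _ _) a).

Record PsNat {C D : TwoCat} (F G : TwoFunctor C D) : Type := {
  pn1 :> forall X, Hom (F X) (G X);
  pn2 : forall X Y, Hom X Y -> mor (Hom (F X) (G Y));
  pn2_dom : forall X Y (f : Hom X Y), dom (pn2 f) = map1 G f · pn1 X;
  pn2_cod : forall X Y (f : Hom X Y), cod (pn2 f) = pn1 Y · map1 F f;
  pn2_inv : forall X Y (f : Hom X Y), invertible (pn2 f);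
  pn2_id1 : forall X, pn2 (id1 X) = idm (pn1 X);
  pn2_comp1 : forall X Y Z (g : Hom Y Z) (f : Hom X Y) e,
    cmp (pn2 g ▷ map1 F f) (map1 G g ◁ pn2 f) e = pn2 (g · f);
  pn2_nat : forall X Y (a : mor (Hom X Y)) e1 e2,
    cmp (pn2 (cod a)) (map2 G a ▷ pn1 X) e1 = cmp (pn1 Y ◁ map2 F a) (pn2 (dom a)) e2
}.

Definition is_2natural {C D : TwoCat} {F G : TwoFunctor C D} (t : PsNat F G) : Prop :=
  forall X Y (f : Hom X Y), pn2 t f = idm (map1 G f · t X).

Record Modif {C D : TwoCat} (F G : TwoFunctor C D) : Type := {
  mdom : PsNat F G;
  mcod : PsNat F G;
  mcell :> forall X, mor (Hom (F X) (G X));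
  mcell_dom : forall X, dom (mcell X) = mdom X;
  mcell_cod : forall X, cod (mcell X) = mcod X;
  mcell_nat : forall X Y (f : Hom X Y) e1 e2,
    cmp (mcell Y ▷ map1 F f) (pn2 mdom f) e1 = cmp (pn2 mcod f) (map1 G f ◁ mcell X) e2
}.

(* [tc] is a total extension of [cmp], used only inside the proofs below to
   rewrite without carrying composability proofs. *)
Definition tc {X : Cat} (g f : mor X) : mor X :=
  match excluded_middle_informative (dom g = cod f) with
  | left e => cmp g f e
  | right _ => f
  end.

Lemma cmp_tc {X : Cat} (g f : mor X) e : cmp g f e = tc g f.
Proof.
  unfold tc; destruct excluded_middle_informative as [e'|n]; [|contradiction].
  f_equal; apply proof_irrelevance.
Qed.

Lemma dom_tc {X : Cat} (g f : mor X) : dom g = cod f -> dom (tc g f) = dom f.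
Proof. intro e; rewrite <- (cmp_tc e); apply dom_cmp. Qed.

Lemma cod_tc {X : Cat} (g f : mor X) : dom g = cod f -> cod (tc g f) = cod g.
Proof. intro e; rewrite <- (cmp_tc e); apply cod_cmp. Qed.

Lemma tc_idl {X : Cat} x (f : mor X) : x = cod f -> tc (idm x) f = f.
Proof.
  intros ->. assert (e : dom (idm (cod f)) = cod f) by apply dom_idm.
  rewrite <- (cmp_tc e); apply cmp_idl.
Qed.

Lemma tc_idr {X : Cat} x (f : mor X) : x = dom f -> tc f (idm x) = f.
Proof.
  intros ->. assert (e : dom f = cod (idm (dom f))) by (symmetry; apply cod_idm).
  rewrite <- (cmp_tc e); apply cmp_idr.
Qed.

Lemma tc_assoc {X : Cat} (h g f : mor X) :
  dom h = cod g -> dom g = cod f -> tc h (tc g f) = tc (tc h g) f.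
Proof.
  intros e1 e2.
  assert (e3 : dom h = cod (cmp g f e2)) by (rewrite cod_cmp; exact e1).
  assert (e4 : dom (cmp h g e1) = cod f) by (rewrite dom_cmp; exact e2).
  rewrite <- (cmp_tc e2), <- (cmp_tc e1), <- (cmp_tc e3), <- (cmp_tc e4).
  apply cmp_assoc.
Qed.

Lemma fmor_tc {X Y : Cat} (F : Functor X Y) b a :
  dom b = cod a -> fmor F (tc b a) = tc (fmor F b) (fmor F a).
Proof.
  intro e.
  assert (e' : dom (fmor F b) = cod (fmor F a)) by (rewrite fdom, fcod, e; reflexivity).
  rewrite <- (cmp_tc e), <- (cmp_tc e'). apply fcmp.
Qed.

Lemma comp2_tc {K : TwoCat} {A B C : K} (b' b : mor (Hom B C)) (a' a : mor (Hom A B)) :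
  dom b' = cod b -> dom a' = cod a -> tc b' b ⋆ tc a' a = tc (b' ⋆ a') (b ⋆ a).
Proof.
  intros e1 e2.
  assert (e3 : dom (b' ⋆ a') = cod (b ⋆ a))
    by (rewrite dom_comp2, cod_comp2, e1, e2; reflexivity).
  rewrite <- (cmp_tc e1), <- (cmp_tc e2), <- (cmp_tc e3). apply comp2_cmp.
Qed.

Lemma lw_tc {K : TwoCat} {A B C : K} (g : Hom B C) (a' a : mor (Hom A B)) :
  dom a' = cod a -> g ◁ tc a' a = tc (g ◁ a') (g ◁ a).
Proof.
  intro e. rewrite <- comp2_tc by (rewrite ?dom_idm, ?cod_idm; auto).
  rewrite tc_idl by (rewrite ?cod_idm; auto). reflexivity.
Qed.

Lemma rw_tc {K : TwoCat} {A B C : K} (b' b : mor (Hom B C)) (f : Hom A B) :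
  dom b' = cod b -> tc b' b ▷ f = tc (b' ▷ f) (b ▷ f).
Proof.
  intro e. rewrite <- comp2_tc by (rewrite ?dom_idm, ?cod_idm; auto).
  rewrite tc_idl by (rewrite ?cod_idm; auto). reflexivity.
Qed.

(* Both ways of decomposing a horizontal composite. *)
Lemma comp2_lr {K : TwoCat} {A B C : K} (b : mor (Hom B C)) (a : mor (Hom A B)) :
  tc (cod b ◁ a) (b ▷ dom a) = b ⋆ a.
Proof.
  rewrite <- comp2_tc by (rewrite ?dom_idm, ?cod_idm; auto).
  rewrite tc_idl, tc_idr; reflexivity.
Qed.

Lemma comp2_rl {K : TwoCat} {A B C : K} (b : mor (Hom B C)) (a : mor (Hom A B)) :
  tc (b ▷ cod a) (dom b ◁ a) = b ⋆ a.
Proof.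
  rewrite <- comp2_tc by (rewrite ?dom_idm, ?cod_idm; auto).
  rewrite tc_idl, tc_idr; reflexivity.
Qed.

Lemma lw_lw {K : TwoCat} {A B C D : K} (h : Hom C D) (g : Hom B C) (a : mor (Hom A B)) :
  h ◁ (g ◁ a) = (h · g) ◁ a.
Proof. rewrite comp2_assoc, comp2_idm; reflexivity. Qed.

Lemma rw_rw {K : TwoCat} {A B C D : K} (a : mor (Hom C D)) (g : Hom B C) (f : Hom A B) :
  (a ▷ g) ▷ f = a ▷ (g · f).
Proof. rewrite <- comp2_assoc, comp2_idm; reflexivity. Qed.

Lemma lw_rw {K : TwoCat} {A B C D : K} (h : Hom C D) (a : mor (Hom B C)) (f : Hom A B) :
  h ◁ (a ▷ f) = (h ◁ a) ▷ f.
Proof. apply comp2_assoc. Qed.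

Lemma pn2_comp1_tc {C D : TwoCat} {F G : TwoFunctor C D} (t : PsNat F G) X Y Z
    (g : Hom Y Z) (f : Hom X Y) :
  pn2 t (g · f) = tc (pn2 t g ▷ map1 F f) (map1 G g ◁ pn2 t f).
Proof.
  assert (e : dom (pn2 t g ▷ map1 F f) = cod (map1 G g ◁ pn2 t f)).
  { rewrite dom_comp2, cod_comp2, dom_idm, cod_idm, pn2_dom, pn2_cod.
    symmetry; apply comp1_assoc. }
  rewrite <- (pn2_comp1 e). apply cmp_tc.
Qed.

Lemma pn2_nat_tc {C D : TwoCat} {F G : TwoFunctor C D} (t : PsNat F G) X Y
    (a : mor (Hom X Y)) :
  tc (pn2 t (cod a)) (map2 G a ▷ t X) = tc (t Y ◁ map2 F a) (pn2 t (dom a)).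
Proof.
  assert (e1 : dom (pn2 t (cod a)) = cod (map2 G a ▷ t X))
    by (rewrite cod_comp2, cod_idm, pn2_dom, fcod; reflexivity).
  assert (e2 : dom (t Y ◁ map2 F a) = cod (pn2 t (dom a)))
    by (rewrite dom_comp2, dom_idm, pn2_cod, fdom; reflexivity).
  rewrite <- (cmp_tc e1), <- (cmp_tc e2). apply pn2_nat.
Qed.

Lemma mcell_nat_tc {C D : TwoCat} {F G : TwoFunctor C D} (r : Modif F G) X Y
    (f : Hom X Y) :
  tc (r Y ▷ map1 F f) (pn2 (mdom r) f) = tc (pn2 (mcod r) f) (map1 G f ◁ r X).
Proof.
  assert (e1 : dom (r Y ▷ map1 F f) = cod (pn2 (mdom r) f))
    by (rewrite dom_comp2, dom_idm, pn2_cod, mcell_dom; reflexivity).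
  assert (e2 : dom (pn2 (mcod r) f) = cod (map1 G f ◁ r X))
    by (rewrite cod_comp2, cod_idm, pn2_dom, mcell_cod; reflexivity).
  rewrite <- (cmp_tc e1), <- (cmp_tc e2). apply mcell_nat.
Qed.

Lemma invertible_idm {X : Cat} (x : X) : invertible (idm x).
Proof.
  assert (e : dom (idm x) = cod (idm x)) by (rewrite dom_idm, cod_idm; reflexivity).
  exists (idm x), e, e. rewrite cmp_tc, dom_idm, cod_idm.
  rewrite tc_idl by (rewrite cod_idm; reflexivity). auto.
Qed.

Lemma invertible_tc {X : Cat} (b a : mor X) :
  dom b = cod a -> invertible b -> invertible a -> invertible (tc b a).
Proof.
  intros e (b' & eb1 & eb2 & Hb1 & Hb2) (a' & ea1 & ea2 & Ha1 & Ha2).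
  rewrite cmp_tc in Hb1; rewrite cmp_tc in Hb2; rewrite cmp_tc in Ha1; rewrite cmp_tc in Ha2.
  assert (db : cod b' = dom b) by auto. assert (da : cod a' = dom a) by auto.
  assert (e' : dom a' = cod b') by congruence.
  assert (e1 : dom (tc a' b') = cod (tc b a)) by (rewrite dom_tc, cod_tc; auto).
  assert (e2 : dom (tc b a) = cod (tc a' b')) by (rewrite dom_tc, cod_tc; auto).
  exists (tc a' b'), e1, e2. rewrite !cmp_tc. split.
  - rewrite tc_assoc by (rewrite ?dom_tc; auto).
    rewrite <- (@tc_assoc _ a' b' b) by auto. rewrite Hb1.
    rewrite tc_idr by congruence. rewrite dom_tc by auto; auto.
  - rewrite tc_assoc by (rewrite ?dom_tc; auto).
    rewrite <- (@tc_assoc _ b a a') by auto. rewrite Ha2.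
    rewrite tc_idr by congruence. rewrite cod_tc by auto; auto.
Qed.

Lemma invertible_comp2 {K : TwoCat} {A B C : K} (b : mor (Hom B C)) (a : mor (Hom A B)) :
  invertible b -> invertible a -> invertible (b ⋆ a).
Proof.
  intros (b' & eb1 & eb2 & Hb1 & Hb2) (a' & ea1 & ea2 & Ha1 & Ha2).
  rewrite cmp_tc in Hb1; rewrite cmp_tc in Hb2; rewrite cmp_tc in Ha1; rewrite cmp_tc in Ha2.
  assert (e1 : dom (b' ⋆ a') = cod (b ⋆ a)) by (rewrite dom_comp2, cod_comp2; congruence).
  assert (e2 : dom (b ⋆ a) = cod (b' ⋆ a')) by (rewrite dom_comp2, cod_comp2; congruence).
  exists (b' ⋆ a'), e1, e2. rewrite !cmp_tc, <- !comp2_tc by auto.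
  rewrite Hb1, Hb2, Ha1, Ha2, !comp2_idm, dom_comp2, cod_comp2. auto.
Qed.

(* Solves composability goals: computes all domains and codomains, then
   normalises 1-cells to left-associated form. *)
Ltac dc :=
  repeat first
    [ rewrite dom_idm | rewrite cod_idm | rewrite dom_comp2 | rewrite cod_comp2
    | rewrite fdom | rewrite fcod | rewrite pn2_dom | rewrite pn2_cod
    | rewrite mcell_dom | rewrite mcell_cod
    | rewrite dom_tc by dc | rewrite cod_tc by dc
    | rewrite dom_cmp | rewrite cod_cmp ];
  repeat first
    [ rewrite fmap_comp1 | rewrite fmap_id1 | rewrite comp1_idl | rewrite comp1_idr
    | rewrite comp1_assoc ];
  try solve [reflexivity | assumption | congruence].

Lemma PsNat_eq {C D : TwoCat} {F G : TwoFunctor C D} (s t : PsNat F G) :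
  (forall X, s X = t X) -> (forall X Y (f : Hom X Y), pn2 s f = pn2 t f) -> s = t.
Proof.
  destruct s as [s1 s2], t as [t1 t2]; simpl; intros H1 H2.
  assert (s1 = t1) by (extensionality X; apply H1).
  assert (s2 = t2) by (extensionality X; extensionality Y; extensionality f; apply H2).
  subst; f_equal; apply proof_irrelevance.
Qed.

Lemma Modif_eq {C D : TwoCat} {F G : TwoFunctor C D} (r s : Modif F G) :
  mdom r = mdom s -> mcod r = mcod s -> (forall X, r X = s X) -> r = s.
Proof.
  destruct r as [rd rc r], s as [sd sc s]; simpl; intros H1 H2 H3.
  assert (r = s) by (extensionality X; apply H3).
  subst; f_equal; apply proof_irrelevance.
Qed.

Definition idmodif {C D : TwoCat} {F G : TwoFunctor C D} (t : PsNat F G) : Modif F G.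
Proof.
  refine {| mdom := t; mcod := t; mcell := fun X => idm (t X) |}.
  - intro X; dc.
  - intro X; dc.
  - intros X Y f e1 e2. rewrite !cmp_tc, !comp2_idm, tc_idl, tc_idr; dc.
Defined.

Definition vmodif {C D : TwoCat} {F G : TwoFunctor C D} (s r : Modif F G)
    (e : mdom s = mcod r) : Modif F G.
Proof.
  assert (ec : forall X, dom (s X) = cod (r X))
    by (intro X; rewrite mcell_dom, mcell_cod, e; reflexivity).
  refine {| mdom := mdom r; mcod := mcod s; mcell := fun X => cmp (s X) (r X) (ec X) |}.
  - intro X; dc.
  - intro X; dc.
  - intros X Y f e1 e2. rewrite !cmp_tc.
    assert (E : forall X, s.(mdom) X = r.(mcod) X) by (intro; rewrite e; reflexivity).
    rewrite rw_tc, lw_tc by auto.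
    rewrite <- tc_assoc by (dc; rewrite E; reflexivity).
    rewrite mcell_nat_tc.
    rewrite tc_assoc by (dc; rewrite E; reflexivity).
    rewrite <- e, mcell_nat_tc. rewrite tc_assoc; [reflexivity | dc | ].
    dc; rewrite E; reflexivity.
Defined.

Definition PsNatCat {C D : TwoCat} (F G : TwoFunctor C D) : Cat.
Proof.
  refine {| ob := PsNat F G; mor := Modif F G; dom := @mdom _ _ F G; cod := @mcod _ _ F G;
            idm := @idmodif _ _ F G; cmp := @vmodif _ _ F G |}; try reflexivity.
  - intros f e; apply Modif_eq; try reflexivity. intro X; simpl.
    rewrite cmp_tc, tc_idl; dc.
  - intros f e; apply Modif_eq; try reflexivity. intro X; simpl.
    rewrite cmp_tc, tc_idr; dc.
  - intros h g f e1 e2 e3 e4; apply Modif_eq; try reflexivity. intro X; simpl.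
    rewrite !cmp_tc. simpl in *.
    apply tc_assoc; rewrite mcell_dom, mcell_cod; congruence.
Defined.

Definition FullSub (X : Cat) (P : X -> Prop) : Cat.
Proof.
  assert (Pid : forall x : {x : X | P x},
            P (dom (idm (proj1_sig x))) /\ P (cod (idm (proj1_sig x)))).
  { intros [x p]; simpl. rewrite dom_idm, cod_idm; auto. }
  assert (Pcmp : forall (g f : {a : mor X | P (dom a) /\ P (cod a)}) e,
            P (dom (cmp (proj1_sig g) (proj1_sig f) e)) /\
            P (cod (cmp (proj1_sig g) (proj1_sig f) e))).
  { intros [g [q1 q2]] [f [p1 p2]] e; simpl in *. rewrite dom_cmp, cod_cmp; auto. }
  refine {| ob := {x : X | P x};
            mor := {a : mor X | P (dom a) /\ P (cod a)};
            dom := fun a => exist _ (dom (proj1_sig a)) (proj1 (proj2_sig a));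
            cod := fun a => exist _ (cod (proj1_sig a)) (proj2 (proj2_sig a));
            idm := fun x => exist _ (idm (proj1_sig x)) (Pid x);
            cmp := fun g f e => exist _ (cmp (proj1_sig g) (proj1_sig f)
                                           (f_equal (@proj1_sig _ _) e)) (Pcmp _ _ _) |}.
  - intros [x p]; apply subset_eq_compat, dom_idm.
  - intros [x p]; apply subset_eq_compat, cod_idm.
  - intros g f e; apply subset_eq_compat, dom_cmp.
  - intros g f e; apply subset_eq_compat, cod_cmp.
  - intros [f p] e; apply subset_eq_compat, cmp_idl.
  - intros [f p] e; apply subset_eq_compat, cmp_idr.
  - intros h g f e1 e2 e3 e4; apply subset_eq_compat; simpl. apply cmp_assoc.
Defined.

Definition pid {C D : TwoCat} (F : TwoFunctor C D) : PsNat F F.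
Proof.
  refine {| pn1 := fun X => id1 (F X); pn2 := fun X Y f => idm (map1 F f) |}.
  - intros; dc.
  - intros; dc.
  - intros; apply invertible_idm.
  - intros; rewrite fmap_id1; reflexivity.
  - intros. rewrite cmp_tc, !comp2_idm, tc_idl, fmap_comp1; dc.
  - intros. rewrite !cmp_tc, comp2_idl, comp2_idr, tc_idl, tc_idr; dc.
Defined.

Definition pcomp {C D : TwoCat} {F G H : TwoFunctor C D} (t : PsNat G H) (s : PsNat F G) :
  PsNat F H.
Proof.
  assert (e : forall X Y (f : Hom X Y), dom (t Y ◁ pn2 s f) = cod (pn2 t f ▷ s X)).
  { intros; dc. }
  refine {| pn1 := fun X => t X · s X;
            pn2 := fun X Y f => cmp (t Y ◁ pn2 s f) (pn2 t f ▷ s X) (e X Y f) |}.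
  - intros; dc.
  - intros; dc.
  - intros. rewrite cmp_tc. apply invertible_tc; [dc| |];
    apply invertible_comp2; auto using invertible_idm, pn2_inv.
  - intros. rewrite cmp_tc, !pn2_id1, !comp2_idm, tc_idl; dc.
  - intros. rewrite !cmp_tc, !pn2_comp1_tc.
    rewrite !rw_tc, !lw_tc by dc.
    assert (M : tc (pn2 t g ▷ s Y ▷ map1 F f) (map1 H g ◁ (t Y ◁ pn2 s f))
              = tc (t Z ◁ (map1 G g ◁ pn2 s f)) (pn2 t g ▷ map1 G f ▷ s X)).
    { rewrite !rw_rw, !lw_lw.
      rewrite <- (pn2_dom t g), <- (pn2_cod t g), <- (pn2_dom s f), <- (pn2_cod s f).
      rewrite comp2_lr, comp2_rl; reflexivity. }
    rewrite lw_rw.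
    rewrite <- tc_assoc by dc.
    rewrite (@tc_assoc _ (pn2 t g ▷ s Y ▷ map1 F f)) by dc.
    rewrite M, lw_rw.
    rewrite <- !tc_assoc by dc.
    reflexivity.
  - intros. rewrite !cmp_tc.
    rewrite <- tc_assoc by dc. rewrite <- rw_rw, <- rw_tc by dc.
    rewrite pn2_nat_tc. rewrite rw_tc by dc. rewrite tc_assoc by dc.
    rewrite <- lw_rw, <- lw_tc, pn2_nat_tc, lw_tc by dc.
    rewrite lw_lw. rewrite <- tc_assoc by dc. reflexivity.
Defined.

Definition hmodif {C D : TwoCat} {F G H : TwoFunctor C D} (s : Modif G H) (r : Modif F G) :
  Modif F H.
Proof.
  refine {| mdom := pcomp (mdom s) (mdom r); mcod := pcomp (mcod s) (mcod r);
            mcell := fun X => s X ⋆ r X |}.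
  - intro X; simpl; dc.
  - intro X; simpl; dc.
  - intros X Y f e1 e2. simpl. rewrite !cmp_tc.
    rewrite <- (comp2_assoc (s Y)).
    rewrite tc_assoc by dc.
    rewrite <- (@comp2_tc _ _ _ _ (s Y)) by dc.
    rewrite mcell_nat_tc.
    replace (tc (s Y) (idm (mdom s Y))) with (tc (idm (mcod s Y)) (s Y))
      by (rewrite tc_idl, tc_idr; dc).
    rewrite comp2_tc by dc.
    rewrite (comp2_assoc (s Y)).
    rewrite <- tc_assoc by dc.
    rewrite <- (@comp2_tc _ _ _ _ (s Y ▷ map1 G f)) by dc.
    rewrite mcell_nat_tc.
    replace (tc (r X) (idm (mdom r X))) with (tc (idm (mcod r X)) (r X))
      by (rewrite tc_idl, tc_idr; dc).
    rewrite comp2_tc by dc.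
    rewrite tc_assoc by dc.
    rewrite comp2_assoc. reflexivity.
Defined.

Inductive kind : Set := strict | pseudo.

(* [HOM strict C D] and [HOM pseudo C D] have the 2-functors as objects and the
   2-natural, resp. all pseudonatural, transformations as 1-cells: for
   [k = pseudo] the condition [allowed] is vacuous. *)
Definition allowed (k : kind) {C D : TwoCat} {F G : TwoFunctor C D} (t : PsNat F G) : Prop :=
  k = strict -> is_2natural t.

Lemma allowed_pid k {C D : TwoCat} (F : TwoFunctor C D) : allowed k (pid F).
Proof. intros _ X Y f; simpl; dc. Qed.

Lemma allowed_pcomp k {C D : TwoCat} {F G H : TwoFunctor C D} (t : PsNat G H) (s : PsNat F G) :
  allowed k t -> allowed k s -> allowed k (pcomp t s).
Proof.
  intros Ht Hs ek X Y f; specialize (Ht ek X Y f); specialize (Hs ek X Y f).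
  assert (N : map1 G f · s X = s Y · map1 F f).
  { rewrite <- (pn2_cod s f), Hs, cod_idm; reflexivity. }
  assert (M : map1 H f · t X = t Y · map1 G f).
  { rewrite <- (pn2_cod t f), Ht, cod_idm; reflexivity. }
  simpl. rewrite cmp_tc, Ht, Hs, !comp2_idm, M, <- comp1_assoc.
  rewrite tc_idl by (rewrite cod_idm; reflexivity).
  rewrite !comp1_assoc, M. reflexivity.
Qed.

Lemma pcomp_idl {C D : TwoCat} {F G : TwoFunctor C D} (s : PsNat F G) : pcomp (pid G) s = s.
Proof.
  apply PsNat_eq; intros; simpl; [apply comp1_idl|].
  rewrite cmp_tc, comp2_idl, comp2_idm, tc_idr; dc.
Qed.

Lemma pcomp_idr {C D : TwoCat} {F G : TwoFunctor C D} (s : PsNat F G) : pcomp s (pid F) = s.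
Proof.
  apply PsNat_eq; intros; simpl; [apply comp1_idr|].
  rewrite cmp_tc, comp2_idr, comp2_idm, tc_idl; dc.
Qed.

Lemma pcomp_assoc {C D : TwoCat} {F G H K : TwoFunctor C D}
    (u : PsNat H K) (t : PsNat G H) (s : PsNat F G) :
  pcomp u (pcomp t s) = pcomp (pcomp u t) s.
Proof.
  apply PsNat_eq; intros; simpl; [apply comp1_assoc|].
  rewrite !cmp_tc. rewrite lw_tc, rw_tc by dc.
  rewrite !lw_lw, !rw_rw, !lw_rw, tc_assoc; dc.
Qed.

Lemma hmodif_id {C D : TwoCat} {F G H : TwoFunctor C D} (t : PsNat G H) (s : PsNat F G) :
  hmodif (idmodif t) (idmodif s) = idmodif (pcomp t s).
Proof. apply Modif_eq; simpl; [reflexivity | reflexivity |]. intro X; apply comp2_idm. Qed.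

Lemma hmodif_vmodif {C D : TwoCat} {F G H : TwoFunctor C D} (b' b : Modif G H)
    (a' a : Modif F G) e1 e2 e3 :
  hmodif (vmodif (s := b') (r := b) e1) (vmodif (s := a') (r := a) e2)
  = vmodif (s := hmodif b' a') (r := hmodif b a) e3.
Proof.
  apply Modif_eq; simpl; [reflexivity | reflexivity |]. intro X. rewrite !cmp_tc.
  apply comp2_tc; rewrite mcell_dom, mcell_cod; [rewrite e1 | rewrite e2]; reflexivity.
Qed.

Lemma hmodif_idl {C D : TwoCat} {F G : TwoFunctor C D} (a : Modif F G) :
  hmodif (idmodif (pid G)) a = a.
Proof. apply Modif_eq; simpl; [apply pcomp_idl | apply pcomp_idl |]. intro; apply comp2_idl. Qed.

Lemma hmodif_idr {C D : TwoCat} {F G : TwoFunctor C D} (a : Modif F G) :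
  hmodif a (idmodif (pid F)) = a.
Proof. apply Modif_eq; simpl; [apply pcomp_idr | apply pcomp_idr |]. intro; apply comp2_idr. Qed.

Lemma hmodif_assoc {C D : TwoCat} {F G H K : TwoFunctor C D}
    (c : Modif H K) (b : Modif G H) (a : Modif F G) :
  hmodif c (hmodif b a) = hmodif (hmodif c b) a.
Proof.
  apply Modif_eq; simpl; [apply pcomp_assoc | apply pcomp_assoc |].
  intro; apply comp2_assoc.
Qed.

Definition HOM (k : kind) (C D : TwoCat) : TwoCat.
Proof.
  refine {|
    Ob := TwoFunctor C D;
    Hom := fun F G => @FullSub (PsNatCat F G) (fun t => allowed k t);
    id1 := fun F => exist _ (pid F) (@allowed_pid k _ _ F);
    comp1 := fun F G H t s => exist _ (pcomp (proj1_sig t) (proj1_sig s))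
      (allowed_pcomp (proj2_sig t) (proj2_sig s));
    comp2 := fun F G H s r => exist _ (hmodif (proj1_sig s) (proj1_sig r))
      (conj (allowed_pcomp (proj1 (proj2_sig s)) (proj1 (proj2_sig r)))
            (allowed_pcomp (proj2 (proj2_sig s)) (proj2 (proj2_sig r)))) |}.
  - intros; apply subset_eq_compat; reflexivity.
  - intros; apply subset_eq_compat; reflexivity.
  - intros F G H [t pt] [s ps]; apply subset_eq_compat; simpl; apply hmodif_id.
  - intros F G H [b' pb'] [b pb] [a' pa'] [a pa] e1 e2 e3.
    apply subset_eq_compat; simpl; apply hmodif_vmodif.
  - intros F G [t pt]; apply subset_eq_compat; simpl; apply pcomp_idl.
  - intros F G [t pt]; apply subset_eq_compat; simpl; apply pcomp_idr.
  - intros F G H K [u pu] [t pt] [s ps]; apply subset_eq_compat; simpl; apply pcomp_assoc.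
  - intros F G [a pa]; apply subset_eq_compat; simpl; apply hmodif_idl.
  - intros F G [a pa]; apply subset_eq_compat; simpl; apply hmodif_idr.
  - intros F G H K [c pc] [b pb] [a pa]; apply subset_eq_compat; simpl; apply hmodif_assoc.
Defined.

(* The transformation underlying a 1-cell, and the modification underlying a
   2-cell, of [HOM k C D]. *)
Definition nat_of {k} {C D : TwoCat} {F G : HOM k C D} (t : Hom F G) :
  PsNat (F : TwoFunctor C D) G := proj1_sig t.

Definition modif_of {k} {C D : TwoCat} {F G : HOM k C D} (r : mor (Hom F G)) :
  Modif (F : TwoFunctor C D) G := proj1_sig r.

Definition ev_map {k} {C D : TwoCat} (F G : HOM k C D) (X : C) :
  Functor (Hom F G) (Hom ((F : TwoFunctor C D) X) ((G : TwoFunctor C D) X)).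
Proof.
  refine {| fob := fun t : Hom F G => nat_of t X;
            fmor := fun r : mor (Hom F G) => modif_of r X |}.
  - intros; apply mcell_dom.
  - intros; apply mcell_cod.
  - reflexivity.
  - intros b a e e'; unfold modif_of; simpl. rewrite !cmp_tc. reflexivity.
Defined.

Definition ev (k : kind) {C : TwoCat} (D : TwoCat) (X : C) : TwoFunctor (HOM k C D) D.
Proof.
  refine (MkTwoFunctor (fun F : HOM k C D => (F : TwoFunctor C D) X)
            {| fmap := fun F G : HOM k C D => ev_map F G X |}); reflexivity.
Defined.

Definition fun_comp {X Y Z : Cat} (G : Functor Y Z) (F : Functor X Y) : Functor X Z.
Proof.
  refine {| fob := fun x => G (F x); fmor := fun a => fmor G (fmor F a) |}.
  - intros; rewrite !fdom; reflexivity.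
  - intros; rewrite !fcod; reflexivity.
  - intros; rewrite !fidm; reflexivity.
  - intros b a e e'; rewrite !cmp_tc, !fmor_tc; dc.
Defined.

Definition tf_comp {C D E : TwoCat} (G : TwoFunctor D E) (F : TwoFunctor C D) :
  TwoFunctor C E.
Proof.
  refine (MkTwoFunctor (fun X => G (F X))
    {| fmap := fun X Y => fun_comp (fmap (tstr G) (F X) (F Y)) (fmap (tstr F) X Y) |}).
  - intros; simpl; rewrite !fmap_id1; reflexivity.
  - intros; simpl; rewrite !fmap_comp1; reflexivity.
  - intros; simpl; rewrite !fmap_comp2; reflexivity.
Defined.

Definition const_fun (X : Cat) {Y : Cat} (y : Y) : Functor X Y.
Proof.
  refine {| fob := fun _ : X => y; fmor := fun _ : mor X => idm y |}.
  - intros; apply dom_idm.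
  - intros; apply cod_idm.
  - reflexivity.
  - intros; rewrite !cmp_tc, tc_idl; dc.
Defined.

Definition const (I : TwoCat) {A : TwoCat} (V : A) : TwoFunctor I A.
Proof.
  refine (MkTwoFunctor (fun _ : I => V)
    {| fmap := fun i j => const_fun (Hom i j) (id1 V) |}).
  - reflexivity.
  - intros; simpl; rewrite comp1_idl; reflexivity.
  - intros; simpl; rewrite comp2_idl; reflexivity.
Defined.

Definition PsCone {I A : TwoCat} (F : TwoFunctor I A) (V : A) : Type := PsNat F (const I V).

Definition PsConeCat {I A : TwoCat} (F : TwoFunctor I A) (V : A) : Cat :=
  PsNatCat F (const I V).

Lemma cone_dom {I A : TwoCat} {F : TwoFunctor I A} {V : A} (lam : PsCone F V) i j
    (u : Hom i j) : @dom (Hom (F i) V) (pn2 lam u) = lam i.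
Proof. etransitivity; [exact (pn2_dom lam u) | apply comp1_idl]. Qed.

Lemma cone_cod {I A : TwoCat} {F : TwoFunctor I A} {V : A} (lam : PsCone F V) i j
    (u : Hom i j) : @cod (Hom (F i) V) (pn2 lam u) = @comp1 A (F i) (F j) V (lam j) (map1 F u).
Proof. exact (pn2_cod lam u). Qed.

Lemma cone_id1 {I A : TwoCat} {F : TwoFunctor I A} {V : A} (lam : PsCone F V) (i : I) :
  pn2 lam (id1 i) = @idm (Hom (F i) V) (lam i).
Proof. exact (pn2_id1 lam i). Qed.

Lemma cone_comp1 {I A : TwoCat} {F : TwoFunctor I A} {V : A} (lam : PsCone F V) i j k
    (v : Hom j k) (u : Hom i j) :
  pn2 lam (v · u)
  = tc (@comp2 A (F i) (F j) V (pn2 lam v) (idm (map1 F u)))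
       (pn2 lam u : mor (Hom (F i) V)).
Proof.
  rewrite pn2_comp1_tc. simpl. f_equal. apply comp2_idl.
Qed.

Lemma cone_nat {I A : TwoCat} {F : TwoFunctor I A} {V : A} (lam : PsCone F V) i j
    (a : mor (Hom i j)) :
  (pn2 lam (cod a) : mor (Hom (F i) V))
  = tc (@comp2 A (F i) (F j) V (idm (lam j : Hom (F j) V)) (map2 F a)) (pn2 lam (dom a)).
Proof.
  etransitivity; [|exact (pn2_nat_tc lam a)]. simpl.
  symmetry. rewrite comp2_idl. apply tc_idr. symmetry; apply cone_dom.
Qed.

Definition cone_map {I A : TwoCat} {F : TwoFunctor I A} {L : A} (lam : PsCone F L) {V : A}
  (t : Hom L V) : PsCone F V.
Proof.
  refine {| pn1 := fun i => (t · lam i : Hom (F i) (const I V i));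
            pn2 := fun i j u => @comp2 A (F i) L V (idm t) (pn2 lam u) |}.
  - intros; simpl; dc. rewrite cone_dom; reflexivity.
  - intros; simpl; dc. rewrite cone_cod; dc.
  - intros; apply (@invertible_comp2 A (F X) L V);
      [apply invertible_idm | exact (pn2_inv lam f)].
  - intros; rewrite cone_id1. apply comp2_idm.
  - intros. rewrite cone_comp1. simpl in *. rewrite cmp_tc.
    rewrite comp2_idl, lw_tc by (dc; symmetry; etransitivity; [apply cone_cod|];
                                 rewrite cone_dom; reflexivity).
    rewrite lw_rw. reflexivity.
  - intros. simpl in *. rewrite !cmp_tc.
    rewrite comp2_idl, tc_idr by (dc; rewrite cone_dom; reflexivity).
    rewrite cone_nat, lw_tc by (dc; symmetry; apply cone_cod).
    rewrite lw_lw. reflexivity.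
Defined.

Definition cone_modif {I A : TwoCat} {F : TwoFunctor I A} {L : A} (lam : PsCone F L) {V : A}
  (r : mor (Hom L V)) : mor (PsConeCat F V).
Proof.
  refine (({| mdom := cone_map lam (dom r); mcod := cone_map lam (cod r);
              mcell := fun i => (r ▷ lam i : mor (Hom (F i) (const I V i))) |})
          : Modif F (const I V)).
  - intro; simpl; dc.
  - intro; simpl; dc.
  - intros; simpl in *. rewrite !cmp_tc, comp2_idl, rw_rw.
    rewrite <- (cone_dom lam f), <- (cone_cod lam f), comp2_lr, comp2_rl. reflexivity.
Defined.

Definition precomp {I A : TwoCat} {F : TwoFunctor I A} {L : A} (lam : PsCone F L) (V : A) :
  Functor (Hom L V) (PsConeCat F V).
Proof.
  refine {| fob := fun t : Hom L V => (cone_map lam t : PsConeCat F V);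
            fmor := fun r : mor (Hom L V) => cone_modif lam r |}.
  - reflexivity.
  - reflexivity.
  - intro t; apply Modif_eq; simpl; rewrite ?dom_idm, ?cod_idm; try reflexivity.
    intro; apply comp2_idm.
  - intros b a e e'; apply Modif_eq; simpl; rewrite ?dom_cmp, ?cod_cmp; try reflexivity.
    intro; rewrite !cmp_tc. apply rw_tc; assumption.
Defined.

Definition IsPsColim {I A : TwoCat} {F : TwoFunctor I A} {L : A} (lam : PsCone F L) : Prop :=
  forall V : A, IsIsoCat (precomp lam V).

(* [op K] reverses the 1-cells but not the 2-cells. *)
Definition op (K : TwoCat) : TwoCat.
Proof.
  refine {| Ob := Ob K;
            Hom := fun A B => @Hom K B A;
            id1 := fun A => @id1 K A;
            comp1 := fun A B C (g : @Hom K C B) (f : @Hom K B A) => f · g;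
            comp2 := fun A B C (b : mor (@Hom K C B)) (a : mor (@Hom K B A)) => a ⋆ b |}.
  - intros; apply dom_comp2.
  - intros; apply cod_comp2.
  - intros; apply comp2_idm.
  - intros; apply comp2_cmp.
  - intros; apply comp1_idr.
  - intros; apply comp1_idl.
  - intros; symmetry; apply comp1_assoc.
  - intros; apply comp2_idr.
  - intros; apply comp2_idl.
  - intros; symmetry; apply comp2_assoc.
Defined.

Definition dual {I A : TwoCat} (F : TwoFunctor (op I) A) : TwoFunctor I (op A).
Proof.
  refine (@MkTwoFunctor I (op A) (fun i => F i)
            {| fmap := fun i j : I => (fmap (tstr F) j i :
                         Functor (@Hom I i j) (@Hom (op A) (F i) (F j))) |}).
  - intro i; exact (fmap_id1 (tstr F) i).
  - intros i j k v u; exact (@fmap_comp1 _ _ _ (tstr F) k j i u v).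
  - intros i j k b a; exact (@fmap_comp2 _ _ _ (tstr F) k j i a b).
Defined.

(* Pseudolimits of [F : op I -> A] are pseudocolimits of [dual F : I -> op A].
   Read in [A], a cone has projections [pi_i : V -> F i] and invertible 2-cells
   [pi_i => F u · pi_j] for [u : i -> j] in [I]. *)
Definition PsLimCone {I A : TwoCat} (F : TwoFunctor (op I) A) (V : A) : Type :=
  PsCone (dual F) (V : op A).

Definition lim_proj {I A : TwoCat} {F : TwoFunctor (op I) A} {V : A} (pi : PsLimCone F V)
  (i : I) : @Hom A V (F i) := pn1 pi i.

Definition lim_cell {I A : TwoCat} {F : TwoFunctor (op I) A} {V : A} (pi : PsLimCone F V)
  {i j : I} (u : Hom i j) : mor (@Hom A V (F i)) := pn2 pi u.

Definition IsPsLim {I A : TwoCat} {F : TwoFunctor (op I) A} {V : A} (pi : PsLimCone F V) : Prop :=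
  @IsPsColim I (op A) (dual F) V pi.

(* Main.v *)
Require Import Defs.
From Stdlib Require Import ClassicalEpsilon ProofIrrelevance.

Set Implicit Arguments.
Unset Strict Implicit.
Unset Printing Implicit Defensive.

(** Pseudocolimits in a 2-category of 2-functors are computed pointwise, for strict and for
    pseudo 1-cells alike.

    Everything rests on reading the isomorphism of categories that defines a pseudocolimit
    [lam : F => L] as four elementary facts: 1-cells and 2-cells out of [L] are determined by
    their composites with the legs and cells of [lam] ([colim_ext1], [colim_ext2]), and every
    cone, respectively every compatible family of 2-cells, comes from such a 1-cell or 2-cell
    ([colim_desc1], [colim_desc2]); [colim_intro] is the converse.

    The 2-functor [L].  Given [f : X -> Y], the 1-cells [lam^Y_i F_i f] form a cone on the
    evaluation of [F] at [X].  Since [F u : F_i => F_j] is only pseudonatural, its cell at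
    [u : i -> j] is the pasting of [lam^Y_u F_i f] with the inverse of
    [lam^Y_j (F u)_f] ([map1_cone]), so [L f] is the unique 1-cell with
    [L f lam^X_i = lam^Y_i F_i f] and
    [lam^Y_j (F u)_f o L f lam^X_u = lam^Y_u F_i f] ([is_map1]).  The first equation says that
    each [lam_i] is 2-natural, the second that each [lam_u] is a modification.  On 2-cells,
    [L a] is determined by [L a lam^X_i = lam^Y_i F_i a] ([is_map2]).  The predicates hold for
    identities and are closed under the compositions, so uniqueness gives 2-functoriality
    ([pointwise_colim_2functor]).

    The universal property.  For a cone [s] with vertex [V] in the 2-category of 2-functors,
    [t_X : L X -> V X] is induced by the cone [s^X].  The legs [s_i] have structure cells
    [(s_i)_f : V f s^X_i => s^Y_i F_i f], whose endpoints are [V f t_X lam^X_i] and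
    [t_Y L f lam^X_i]; that the [s_u] are modifications is exactly what makes this family
    compatible, so it descends to [t_f : V f t_X => t_Y L f] ([colim_cone_desc1]).  A 2-cell
    out of a pseudocolimit is invertible, or an identity, as soon as its composites with the
    legs are ([colim_invertible], [colim_idm]); hence [t_f] is invertible, and [t] is 2-natural
    whenever all the [s_i] are.  This is how both kinds of 1-cells are treated at once.

    Pseudolimits.  Reversing 1-cells gives a 2-functor, bijective on 1-cells and 2-cells, from
    the opposite of the 2-category of 2-functors [C -> D] to that of 2-functors [op C -> op D]
    ([op_hom], [op_hom_iso]).  Structure cells must be replaced by their inverses, because [op]
    keeps the direction of 2-cells but exchanges the two sides of a naturality square.
    Pseudocolimit cones are lifted and reflected along such a 2-functor ([lift_cone],
    [colim_reflect]), so the limit statement follows from the colimit statement for [op C]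
    and [op D]. *)

(** * Invertible arrows and isomorphisms of categories *)

Definition inv {X : Cat} (a : mor X) : mor X :=
  epsilon (inhabits a) (fun b =>
    dom b = cod a /\ cod b = dom a /\ tc b a = idm (dom a) /\ tc a b = idm (cod a)).

Lemma inv_spec {X : Cat} (a : mor X) : invertible a ->
  dom (inv a) = cod a /\ cod (inv a) = dom a /\
  tc (inv a) a = idm (dom a) /\ tc a (inv a) = idm (cod a).
Proof.
  intros (b & e1 & e2 & H1 & H2); unfold inv; apply epsilon_spec.
  exists b; rewrite cmp_tc in H1, H2; auto.
Qed.

Lemma dom_inv {X : Cat} (a : mor X) : invertible a -> dom (inv a) = cod a.
Proof. intro H; apply (inv_spec H). Qed.

Lemma cod_inv {X : Cat} (a : mor X) : invertible a -> cod (inv a) = dom a.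
Proof. intro H; apply (inv_spec H). Qed.

Lemma tc_inv_l {X : Cat} (a : mor X) : invertible a -> tc (inv a) a = idm (dom a).
Proof. intro H; apply (inv_spec H). Qed.

Lemma tc_inv_r {X : Cat} (a : mor X) : invertible a -> tc a (inv a) = idm (cod a).
Proof. intro H; apply (inv_spec H). Qed.

Lemma invertible_intro {X : Cat} (a b : mor X) :
  dom b = cod a -> cod b = dom a -> tc b a = idm (dom a) -> tc a b = idm (cod a) ->
  invertible a.
Proof.
  intros e1 e2 H1 H2. exists b, e1, (eq_sym e2). rewrite !cmp_tc; auto.
Qed.

Lemma cancel_l {X : Cat} (a x y : mor X) :
  invertible a -> dom a = cod x -> dom a = cod y -> tc a x = tc a y -> x = y.
Proof.
  intros Ha ex ey H. apply (f_equal (tc (inv a))) in H.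
  rewrite !tc_assoc, tc_inv_l, !tc_idl in H; auto using dom_inv.
Qed.

Lemma cancel_r {X : Cat} (a x y : mor X) :
  invertible a -> dom x = cod a -> dom y = cod a -> tc x a = tc y a -> x = y.
Proof.
  intros Ha ex ey H. apply (f_equal (fun z => tc z (inv a))) in H.
  rewrite <- !tc_assoc, tc_inv_r, !tc_idr in H; auto using eq_sym, cod_inv.
Qed.

Lemma invertible_inv {X : Cat} (a : mor X) : invertible a -> invertible (inv a).
Proof.
  intro H; destruct (inv_spec H) as (e1 & e2 & H1 & H2).
  apply invertible_intro with (b := a); congruence.
Qed.

Lemma inv_unique {X : Cat} (a b : mor X) :
  invertible a -> dom b = cod a -> tc b a = idm (dom a) -> b = inv a.
Proof.
  intros Ha e H. apply (cancel_r Ha); auto using dom_inv.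
  rewrite H, tc_inv_l; auto.
Qed.

Lemma inv_inv {X : Cat} (a : mor X) : invertible a -> inv (inv a) = a.
Proof.
  intro H; symmetry; apply inv_unique; auto using invertible_inv, eq_sym, cod_inv.
  rewrite tc_inv_r, dom_inv; auto.
Qed.

Lemma inv_idm {X : Cat} (x : X) : inv (idm x) = idm x.
Proof.
  symmetry; apply inv_unique; auto using invertible_idm; [dc|].
  rewrite tc_idl; dc.
Qed.

Lemma inv_tc {X : Cat} (b a : mor X) : dom b = cod a -> invertible b -> invertible a ->
  inv (tc b a) = tc (inv a) (inv b).
Proof.
  intros e Hb Ha. symmetry. destruct (inv_spec Ha) as (? & ? & ? & ?).
  destruct (inv_spec Hb) as (? & ? & ? & ?).
  apply inv_unique; [apply invertible_tc; auto | dc |].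
  rewrite tc_assoc by dc. rewrite <- (@tc_assoc _ (inv a)) by dc.
  rewrite tc_inv_l, tc_idr, tc_inv_l by dc. dc.
Qed.

Lemma inv_comp2 {K : TwoCat} {A B C : K} (b : mor (Hom B C)) (a : mor (Hom A B)) :
  invertible b -> invertible a -> inv (b ⋆ a) = inv b ⋆ inv a.
Proof.
  intros Hb Ha. symmetry. destruct (inv_spec Ha) as (? & ? & ? & ?).
  destruct (inv_spec Hb) as (? & ? & ? & ?).
  apply inv_unique; [apply invertible_comp2; auto | dc |].
  rewrite <- comp2_tc, !tc_inv_l, comp2_idm by auto. dc.
Qed.

Lemma fmor_invertible {X Y : Cat} (F : Functor X Y) (a : mor X) :
  invertible a -> invertible (fmor F a).
Proof.
  intro H. destruct (inv_spec H) as (? & ? & ? & ?).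
  apply invertible_intro with (b := fmor F (inv a)); [dc | dc | |];
    rewrite <- fmor_tc by auto; [rewrite tc_inv_l | rewrite tc_inv_r]; auto;
    rewrite fidm; dc.
Qed.

(** Arrows suffice: objects are recovered as endpoints of identities, and the inverse of a
    bijection on arrows is automatically functorial. *)
Lemma iso_cat_arrows {X Y : Cat} (F : Functor X Y) :
  IsIsoCat F <-> forall b, exists! a, fmor F a = b.
Proof.
  split.
  - intros (G & _ & H2 & _ & H4) b. exists (fmor G b). split; auto.
    intros a <-; auto.
  - intro H.
    set (g := fun b => proj1_sig (constructive_indefinite_description _ (H b))).
    assert (Fg : forall b, fmor F (g b) = b).
    { intro b; unfold g; destruct constructive_indefinite_description as [a [e u]]; auto. }
    assert (inj : forall a a', fmor F a = fmor F a' -> a = a').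
    { intros a a' e; destruct (H (fmor F a')) as (a0 & _ & u).
      rewrite <- (u a e), <- (u a'); auto. }
    assert (injo : forall x x', F x = F x' -> x = x').
    { intros x x' e; rewrite <- (dom_idm x), <- (dom_idm x').
      f_equal; apply inj; rewrite !fidm, e; auto. }
    assert (Fo : forall y, F (dom (g (idm y))) = y).
    { intro y; rewrite <- fdom, Fg, dom_idm; auto. }
    unshelve eexists.
    { refine {| fob := fun y => dom (g (idm y)); fmor := g |}.
      - intro b; apply injo; rewrite <- fdom, Fg, Fo; auto.
      - intro b; apply injo; rewrite <- fcod, Fg, Fo; auto.
      - intro y; apply inj; rewrite Fg, fidm, Fo; auto.
      - intros b a e e'; apply inj; rewrite Fg, !cmp_tc, fmor_tc, !Fg; auto. }
    simpl; repeat split; auto.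
Qed.

(** * Pseudocones and the universal property of pseudocolimits *)

(** The values of the constant 2-functor at [V] are computed in the types of [leg] and [cell],
    so that the cone laws below hold without whiskerings by [id1 V]. *)
Definition leg {I A : TwoCat} {F : TwoFunctor I A} {V : A} (s : PsCone F V) (i : I) :
  Hom (F i) V := pn1 s i.

Definition cell {I A : TwoCat} {F : TwoFunctor I A} {V : A} (s : PsCone F V) {i j : I}
  (u : Hom i j) : mor (Hom (F i) V) := pn2 s u.

Section Cones.
Context {I A : TwoCat} {F : TwoFunctor I A} {V : A}.

Lemma cell_dom (s : PsCone F V) i j (u : Hom i j) : dom (cell s u) = leg s i.
Proof. exact (cone_dom s u). Qed.

Lemma cell_cod (s : PsCone F V) i j (u : Hom i j) : cod (cell s u) = leg s j · map1 F u.
Proof. exact (cone_cod s u). Qed.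

Lemma cell_inv (s : PsCone F V) i j (u : Hom i j) : invertible (cell s u).
Proof. exact (pn2_inv s u). Qed.

Lemma cell_id1 (s : PsCone F V) (i : I) : cell s (id1 i) = idm (leg s i).
Proof. exact (cone_id1 s i). Qed.

Lemma cell_comp1 (s : PsCone F V) i j k (v : Hom j k) (u : Hom i j) :
  cell s (v · u) = tc (cell s v ▷ map1 F u) (cell s u).
Proof. exact (cone_comp1 s v u). Qed.

Lemma cell_nat (s : PsCone F V) i j (a : mor (Hom i j)) :
  cell s (cod a) = tc (leg s j ◁ map2 F a) (cell s (dom a)).
Proof. exact (cone_nat s a). Qed.

Lemma cone_eq (s t : PsCone F V) :
  (forall i, leg s i = leg t i) ->
  (forall i j (u : Hom i j), cell s u = cell t u) -> s = t.
Proof. exact (@PsNat_eq _ _ F (const I V) s t). Qed.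

Definition mk_cone (s : forall i, Hom (F i) V)
    (c : forall i j, Hom i j -> mor (Hom (F i) V))
    (c_dom : forall i j (u : Hom i j), dom (c i j u) = s i)
    (c_cod : forall i j (u : Hom i j), cod (c i j u) = s j · map1 F u)
    (c_inv : forall i j (u : Hom i j), invertible (c i j u))
    (c_id1 : forall i, c i i (id1 i) = idm (s i))
    (c_comp1 : forall i j k (v : Hom j k) (u : Hom i j),
       c i k (v · u) = tc (c j k v ▷ map1 F u) (c i j u))
    (c_nat : forall i j (a : mor (Hom i j)),
       c i j (cod a) = tc (s j ◁ map2 F a) (c i j (dom a))) : PsCone F V.
Proof.
  refine {| pn1 := fun i => (s i : Hom (F i) (const I V i));
            pn2 := fun i j u => (c i j u : mor (Hom (F i) (const I V j))) |}.
  - intros; simpl; dc.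
  - exact c_cod.
  - exact c_inv.
  - exact c_id1.
  - intros X Y Z g f e; simpl in *. rewrite cmp_tc, comp2_idl, c_comp1; auto.
  - intros X Y a e1 e2; simpl in *. rewrite !cmp_tc, comp2_idl, tc_idr, c_nat; auto.
Defined.

End Cones.

Lemma interchange {K : TwoCat} {A B C : K} (b : mor (Hom B C)) (a : mor (Hom A B)) g g' f f' :
  dom b = g -> cod b = g' -> dom a = f -> cod a = f' ->
  tc (b ▷ f') (g ◁ a) = tc (g' ◁ a) (b ▷ f).
Proof. intros <- <- <- <-; rewrite comp2_lr, comp2_rl; reflexivity. Qed.

Section ConeModif.
Context {I A : TwoCat} {F : TwoFunctor I A} {V : A}.

Definition mk_cone_modif (s t : PsCone F V) (r : forall i, mor (Hom (F i) V))
    (r_dom : forall i, dom (r i) = leg s i) (r_cod : forall i, cod (r i) = leg t i)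
    (r_nat : forall i j (u : Hom i j),
       tc (r j ▷ map1 F u) (cell s u) = tc (cell t u) (r i)) : mor (PsConeCat F V).
Proof.
  refine (({| mdom := s; mcod := t;
              mcell := fun i => (r i : mor (Hom (F i) (const I V i))) |})
          : Modif F (const I V)).
  - exact r_dom.
  - exact r_cod.
  - intros i j u e1 e2; simpl in *. rewrite !cmp_tc, comp2_idl. apply r_nat.
Defined.

Lemma cone_modif_nat (m : mor (PsConeCat F V)) i j (u : Hom i j) :
  tc ((mcell m j : mor (Hom (F j) V)) ▷ map1 F u) (cell (mdom m) u)
  = tc (cell (mcod m) u) (mcell m i : mor (Hom (F i) V)).
Proof. etransitivity; [exact (mcell_nat_tc m u) | simpl; rewrite comp2_idl; reflexivity]. Qed.

End ConeModif.

#[local] Hint Resolve invertible_idm invertible_comp2 invertible_inv pn2_inv cell_inv : core.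

(* Redefined below, once the cells of pointwise cones have their own end rules. *)
Ltac ends_step := fail.

Ltac ends :=
  repeat first
    [ ends_step | rewrite dom_idm | rewrite cod_idm | rewrite dom_comp2 | rewrite cod_comp2
    | rewrite fdom | rewrite fcod | rewrite pn2_dom | rewrite pn2_cod
    | rewrite mcell_dom | rewrite mcell_cod | rewrite cell_dom | rewrite cell_cod
    | rewrite dom_inv by auto | rewrite cod_inv by auto
    | rewrite dom_tc by ends | rewrite cod_tc by ends ];
  dc; auto.

Section Colim.
Context {I A : TwoCat} {F : TwoFunctor I A} {L : A} {lam : PsCone F L}.

Lemma colim_ext2 (H : IsPsColim lam) (V : A) (r r' : mor (Hom L V)) :
  dom r = dom r' -> cod r = cod r' ->
  (forall i, r ▷ leg lam i = r' ▷ leg lam i) -> r = r'.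
Proof.
  intros e1 e2 e3.
  destruct (proj1 (iso_cat_arrows _) (H V) (fmor (precomp lam V) r')) as (r0 & _ & u).
  rewrite <- (u r), <- (u r'); auto.
  apply Modif_eq; simpl; rewrite ?e1, ?e2; auto.
Qed.

Lemma colim_ext1 (H : IsPsColim lam) (V : A) (t t' : Hom L V) :
  (forall i, t · leg lam i = t' · leg lam i) ->
  (forall i j (u : Hom i j), t ◁ cell lam u = t' ◁ cell lam u) -> t = t'.
Proof.
  intros e1 e2. destruct (H V) as (G & H1 & _).
  rewrite <- (H1 t), <- (H1 t'). f_equal. apply cone_eq; auto.
Qed.

Lemma colim_desc1 (H : IsPsColim lam) (V : A) (s : PsCone F V) :
  exists t : Hom L V, (forall i, t · leg lam i = leg s i) /\
    (forall i j (u : Hom i j), t ◁ cell lam u = cell s u).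
Proof.
  destruct (H V) as (G & _ & _ & H3 & _). exists (G s).
  split; intros.
  - exact (f_equal (fun c : PsCone F V => leg c i) (H3 s)).
  - exact (f_equal (fun c : PsCone F V => cell c u) (H3 s)).
Qed.

Lemma colim_desc2 (H : IsPsColim lam) (V : A) (t t' : Hom L V)
    (r : forall i, mor (Hom (F i) V)) :
  (forall i, dom (r i) = t · leg lam i) -> (forall i, cod (r i) = t' · leg lam i) ->
  (forall i j (u : Hom i j),
     tc (r j ▷ map1 F u) (t ◁ cell lam u) = tc (t' ◁ cell lam u) (r i)) ->
  exists q : mor (Hom L V), dom q = t /\ cod q = t' /\ forall i, q ▷ leg lam i = r i.
Proof.
  intros e1 e2 e3.
  set (m := @mk_cone_modif _ _ _ _ (cone_map lam t) (cone_map lam t') r e1 e2 e3).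
  destruct (H V) as (G & H1 & _ & _ & H4). exists (fmor G m).
  split; [|split].
  - rewrite fdom. apply H1.
  - rewrite fcod. apply H1.
  - intro i. pose proof (f_equal (fun n : Modif _ _ => mcell n i) (H4 m)) as E. exact E.
Qed.

Lemma colim_intro :
  (forall V (t t' : Hom L V), (forall i, t · leg lam i = t' · leg lam i) ->
     (forall i j (u : Hom i j), t ◁ cell lam u = t' ◁ cell lam u) -> t = t') ->
  (forall V (r r' : mor (Hom L V)), dom r = dom r' -> cod r = cod r' ->
     (forall i, r ▷ leg lam i = r' ▷ leg lam i) -> r = r') ->
  (forall V (s : PsCone F V), exists t : Hom L V, (forall i, t · leg lam i = leg s i) /\
     (forall i j (u : Hom i j), t ◁ cell lam u = cell s u)) ->
  (forall V (t t' : Hom L V) (r : forall i, mor (Hom (F i) V)),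
     (forall i, dom (r i) = t · leg lam i) -> (forall i, cod (r i) = t' · leg lam i) ->
     (forall i j (u : Hom i j),
        tc (r j ▷ map1 F u) (t ◁ cell lam u) = tc (t' ◁ cell lam u) (r i)) ->
     exists q : mor (Hom L V), dom q = t /\ cod q = t' /\ forall i, q ▷ leg lam i = r i) ->
  IsPsColim lam.
Proof.
  intros ext1 ext2 desc1 desc2 V. apply iso_cat_arrows. intro m.
  destruct (desc1 V (mdom m)) as (t & t1 & t2).
  destruct (desc1 V (mcod m)) as (t' & t1' & t2').
  assert (Ht : cone_map lam t = mdom m) by (apply cone_eq; auto).
  assert (Ht' : cone_map lam t' = mcod m) by (apply cone_eq; auto).
  destruct (desc2 V t t' (fun i => mcell m i)) as (q & q1 & q2 & q3).
  - intro i; rewrite t1; exact (mcell_dom m i).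
  - intro i; rewrite t1'; exact (mcell_cod m i).
  - intros; rewrite t2, t2'. apply cone_modif_nat.
  - exists q; split.
    + apply Modif_eq; simpl; rewrite ?q1, ?q2; auto.
    + intros q' <-. simpl in *.
      apply ext2; [rewrite q1 | rewrite q2 | exact q3];
        [apply (ext1 V) | apply (ext1 V)]; auto.
Qed.

(** This is interchange of [q] with [cell lam u]; it makes [q ▷ leg lam i] a compatible family
    in the sense of [colim_desc2]. *)
Lemma colim_nat (V : A) (q : mor (Hom L V)) i j (u : Hom i j) :
  tc (q ▷ leg lam j ▷ map1 F u) (dom q ◁ cell lam u)
  = tc (cod q ◁ cell lam u) (q ▷ leg lam i).
Proof.
  rewrite rw_rw, <- (cell_dom lam u), <- (cell_cod lam u), comp2_lr, comp2_rl. reflexivity.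
Qed.

(** That the two ends of [q] agree is part of the conclusion: on the legs the hypothesis
    forces it, and on the cells it is [colim_nat] with identities in it. *)
Lemma colim_idm (H : IsPsColim lam) (V : A) (q : mor (Hom L V)) :
  (forall i, q ▷ leg lam i = idm (dom q · leg lam i)) -> q = idm (dom q).
Proof.
  intro e.
  assert (e' : forall i, cod q · leg lam i = dom q · leg lam i).
  { intro i. pose proof (f_equal (@cod _) (e i)) as E. revert E; dc. }
  apply (colim_ext2 H); [dc | | intro; rewrite comp2_idm; auto].
  dc. apply (colim_ext1 H); auto.
  intros i j u. pose proof (colim_nat q u) as N. rewrite !e, comp2_idm in N.
  rewrite tc_idl, tc_idr in N by ends. auto.
Qed.

(** The inverses of the [q ▷ leg lam i] are again a compatible family, and the 2-cell they
    induce is inverse to [q] because it is so on the legs. *)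
Lemma colim_invertible (H : IsPsColim lam) (V : A) (q : mor (Hom L V)) :
  (forall i, invertible (q ▷ leg lam i)) -> invertible q.
Proof.
  intro Hq.
  destruct (colim_desc2 H (t := cod q) (t' := dom q) (r := fun i => inv (q ▷ leg lam i)))
    as (p & p1 & p2 & p3).
  - intro i; rewrite dom_inv; ends.
  - intro i; rewrite cod_inv; ends.
  - intros i j u.
    assert (Hq' : invertible (q ▷ leg lam j ▷ map1 F u))
      by (apply invertible_comp2; auto using invertible_idm).
    apply (cancel_l Hq'); [ends | ends |].
    rewrite !tc_assoc by ends.
    rewrite <- rw_tc, tc_inv_r, colim_nat, comp2_idm, tc_idl by ends.
    rewrite <- tc_assoc, tc_inv_r, tc_idr by ends. reflexivity.
  - apply invertible_intro with (b := p); auto.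
    + apply (colim_ext2 H); [dc | dc |].
      intro i. rewrite rw_tc, p3, tc_inv_l, comp2_idm by auto. dc.
    + apply (colim_ext2 H); [dc | dc |].
      intro i. rewrite rw_tc, p3, tc_inv_r, comp2_idm by auto. dc.
Qed.

End Colim.

(** * Images of cones under a 2-functor *)

Section Image.
Context {I A B : TwoCat} (P : TwoFunctor A B) {F : TwoFunctor I A}.

Definition image_cone {V : A} (s : PsCone F V) : PsCone (tf_comp P F) (P V).
Proof.
  refine (@mk_cone _ _ (tf_comp P F) (P V) (fun i => map1 P (leg s i))
            (fun i j u => map2 P (cell s u)) _ _ _ _ _ _); intros; simpl.
  - ends.
  - ends.
  - apply fmor_invertible, cell_inv.
  - rewrite cell_id1; apply fidm.
  - rewrite cell_comp1, fmor_tc, fmap_comp2, fidm by ends; reflexivity.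
  - rewrite cell_nat, fmor_tc, fmap_comp2, fidm by ends; reflexivity.
Defined.

Context (P_iso : forall X Y : A, IsIsoCat (fmap (tstr P) X Y)).

Lemma map2_inj {X Y : A} (a b : mor (Hom X Y)) : map2 P a = map2 P b -> a = b.
Proof.
  intro e. destruct (P_iso X Y) as (G & _ & H & _). rewrite <- (H a), <- (H b), e; auto.
Qed.

Lemma map1_inj {X Y : A} (f g : Hom X Y) : map1 P f = map1 P g -> f = g.
Proof.
  intro e. destruct (P_iso X Y) as (G & H & _). rewrite <- (H f), <- (H g), e; auto.
Qed.

Lemma map2_invertible {X Y : A} (a : mor (Hom X Y)) : invertible (map2 P a) -> invertible a.
Proof.
  intro H. destruct (P_iso X Y) as (G & _ & e & _). rewrite <- (e a).
  apply fmor_invertible, H.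
Qed.

(** Preimages under the isomorphisms of hom-categories satisfy the cone laws because equations
    and invertibility may be checked after applying [P]. *)
Lemma lift_cone {V : A} (s' : PsCone (tf_comp P F) (P V)) :
  exists s : PsCone F V, image_cone s = s'.
Proof.
  assert (R : forall X Y, exists G : mor (Hom (P X) (P Y)) -> mor (Hom X Y),
             forall b, map2 P (G b) = b).
  { intros X Y; destruct (P_iso X Y) as (G & _ & _ & _ & e). exists (fmor G); auto. }
  set (g := fun X Y => proj1_sig (constructive_indefinite_description _ (R X Y))).
  assert (Pg : forall X Y b, map2 P (g X Y b) = b).
  { intros X Y; unfold g; destruct constructive_indefinite_description; auto. }
  clearbody g.
  pose (l' := fun i => leg s' i : Hom (P (F i)) (P V)).
  pose (c' := fun i j (u : Hom i j) => cell s' u : mor (Hom (P (F i)) (P V))).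
  assert (c_dom : forall i j u, dom (c' i j u) = l' i) by exact (cell_dom s').
  assert (c_cod : forall i j u, cod (c' i j u) = l' j · map1 P (map1 F u))
    by exact (cell_cod s').
  set (l := fun i => dom (g _ _ (idm (l' i)))).
  assert (Pl : forall i, map1 P (l i) = l' i).
  { intro i; unfold l; rewrite <- fdom, Pg; dc. }
  clearbody l.
  unshelve eexists (@mk_cone _ _ F V l (fun i j u => g _ _ (c' i j u)) _ _ _ _ _ _).
  - intros; apply map1_inj; rewrite <- fdom, Pg, Pl; apply c_dom.
  - intros; apply map1_inj; rewrite <- fcod, Pg, fmap_comp1, Pl; apply c_cod.
  - intros; apply map2_invertible; rewrite Pg; exact (cell_inv s' u).
  - intros; apply map2_inj; rewrite Pg, fidm, Pl; exact (cell_id1 s' i).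
  - intros i j k v u. apply map2_inj.
    rewrite fmor_tc, fmap_comp2, fidm, !Pg; [exact (cell_comp1 s' v u)|].
    apply map1_inj; rewrite <- fcod, <- fdom, fmap_comp2, fidm, !Pg.
    dc.
  - intros i j a. apply map2_inj.
    rewrite fmor_tc, fmap_comp2, fidm, !Pg, Pl; [exact (cell_nat s' a)|].
    apply map1_inj; rewrite <- fcod, <- fdom, fmap_comp2, fidm, !Pg.
    dc.
  - apply cone_eq; intros; [apply Pl | apply Pg].
Qed.

(** Only the vertices [P V] are used: cones with vertex [V] and 1-cells into [V] correspond
    to those with vertex [P V] and those into [P V]. *)
Lemma colim_reflect {L : A} (lam : PsCone F L) :
  IsPsColim (image_cone lam) -> IsPsColim lam.
Proof.
  intro H. apply colim_intro.
  - intros V t t' e1 e2. apply map1_inj, (colim_ext1 H).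
    + intro i. change (map1 P t · map1 P (leg lam i) = map1 P t' · map1 P (leg lam i)).
      rewrite <- !fmap_comp1, e1; reflexivity.
    + intros i j u.
      change (map1 P t ◁ map2 P (cell lam u) = map1 P t' ◁ map2 P (cell lam u)).
      rewrite <- !fidm, <- !fmap_comp2, e2; reflexivity.
  - intros V r r' e1 e2 e3. apply map2_inj, (colim_ext2 H).
    + rewrite !fdom, e1; auto.
    + rewrite !fcod, e2; auto.
    + intro i. change (map2 P r ▷ map1 P (leg lam i) = map2 P r' ▷ map1 P (leg lam i)).
      rewrite <- !fidm, <- !fmap_comp2, e3; reflexivity.
  - intros V s. destruct (colim_desc1 H (image_cone s)) as (t' & t1 & t2).
    destruct (P_iso L V) as (G & _ & _ & e & _). exists (G t'). split.
    + intro i; apply map1_inj; rewrite fmap_comp1, e; apply t1.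
    + intros i j u; apply map2_inj; rewrite fmap_comp2, fidm, e; apply t2.
  - intros V t t' r e1 e2 e3.
    destruct (colim_desc2 H (t := map1 P t) (t' := map1 P t') (r := fun i => map2 P (r i)))
      as (q & q1 & q2 & q3).
    + intro i; simpl; rewrite fdom, e1; apply fmap_comp1.
    + intro i; simpl; rewrite fcod, e2; apply fmap_comp1.
    + intros i j u. pose proof (f_equal (fun z => map2 P z) (e3 i j u)) as E. simpl in E.
      assert (d1 : dom (r j ▷ map1 F u) = cod (t ◁ cell lam u)) by (ends; rewrite e1; ends).
      assert (d2 : dom (t' ◁ cell lam u) = cod (r i)) by (ends; rewrite e2; ends).
      rewrite !fmor_tc, !fmap_comp2, !fidm in E by auto. exact E.
    + destruct (P_iso L V) as (G & _ & _ & _ & e).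
      exists (fmor G q). rewrite <- (e q) in q1, q2.
      split; [|split].
      * apply map1_inj; rewrite <- fdom; auto.
      * apply map1_inj; rewrite <- fcod; auto.
      * intro i; apply map2_inj. rewrite fmap_comp2, fidm, e; apply q3.
Qed.

End Image.

(** * Evaluating a diagram of 2-functors at an object *)

(** The lemmas of this section restate the cone calculus for the composite of [F] with
    evaluation at [X], with the composite computed, so that 2-cells live in hom-categories
    between visible values such as [ob_at i X]. *)
Section Pointwise.
Context {I C D : TwoCat} {k : kind} (F : TwoFunctor I (HOM k C D)).

Definition ob_at (i : I) : TwoFunctor C D := F i.

Definition nat_at {i j : I} (u : Hom i j) : PsNat (ob_at i) (ob_at j) := nat_of (map1 F u).

Definition modif_at {i j : I} (a : mor (Hom i j)) : Modif (ob_at i) (ob_at j) :=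
  modif_of (map2 F a).

Lemma nat_at_id1 i : nat_at (id1 i) = pid (ob_at i).
Proof. unfold nat_at; rewrite fmap_id1; reflexivity. Qed.

Lemma nat_at_comp1 i j h (v : Hom j h) (u : Hom i j) :
  nat_at (v · u) = pcomp (nat_at v) (nat_at u).
Proof. unfold nat_at; rewrite fmap_comp1; reflexivity. Qed.

Lemma mdom_at i j (a : mor (Hom i j)) : mdom (modif_at a) = nat_at (dom a).
Proof. unfold nat_at; rewrite <- fdom; reflexivity. Qed.

Lemma mcod_at i j (a : mor (Hom i j)) : mcod (modif_at a) = nat_at (cod a).
Proof. unfold nat_at; rewrite <- fcod; reflexivity. Qed.

Lemma nat_at_comp1_leg i j h (v : Hom j h) (u : Hom i j) X :
  nat_at (v · u) X = nat_at v X · nat_at u X.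
Proof. rewrite nat_at_comp1; reflexivity. Qed.

Lemma nat_at_comp1_cell i j h (v : Hom j h) (u : Hom i j) X Y (f : Hom X Y) :
  pn2 (nat_at (v · u)) f
  = tc (nat_at v Y ◁ pn2 (nat_at u) f) (pn2 (nat_at v) f ▷ nat_at u X).
Proof. rewrite nat_at_comp1; simpl; apply cmp_tc. Qed.

Lemma modif_at_nat i j (a : mor (Hom i j)) X Y (f : Hom X Y) :
  tc (modif_at a Y ▷ map1 (ob_at i) f) (pn2 (nat_at (dom a)) f)
  = tc (pn2 (nat_at (cod a)) f) (map1 (ob_at j) f ◁ modif_at a X).
Proof. rewrite <- mdom_at, <- mcod_at; apply mcell_nat_tc. Qed.

Definition leg_at {X : C} {V : D} (s : PsCone (tf_comp (ev k D X) F) V) (i : I) :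
  Hom (ob_at i X) V := leg s i.

Definition cell_at {X : C} {V : D} (s : PsCone (tf_comp (ev k D X) F) V) {i j : I}
  (u : Hom i j) : mor (Hom (ob_at i X) V) := cell s u.

Section Cone.
Context {X : C} {V : D}.
Implicit Type s : PsCone (tf_comp (ev k D X) F) V.

Lemma cell_at_dom s i j (u : Hom i j) : dom (cell_at s u) = leg_at s i.
Proof. exact (cell_dom s u). Qed.

Lemma cell_at_cod s i j (u : Hom i j) : cod (cell_at s u) = leg_at s j · nat_at u X.
Proof. exact (cell_cod s u). Qed.

Lemma cell_at_inv s i j (u : Hom i j) : invertible (cell_at s u).
Proof. exact (cell_inv s u). Qed.

Lemma cell_at_id1 s (i : I) : cell_at s (id1 i) = idm (leg_at s i).
Proof. exact (cell_id1 s i). Qed.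

Lemma cell_at_comp1 s i j h (v : Hom j h) (u : Hom i j) :
  cell_at s (v · u) = tc (cell_at s v ▷ nat_at u X) (cell_at s u).
Proof. exact (cell_comp1 s v u). Qed.

Lemma cell_at_nat s i j (a : mor (Hom i j)) :
  cell_at s (cod a) = tc (leg_at s j ◁ modif_at a X) (cell_at s (dom a)).
Proof. exact (cell_nat s a). Qed.

Definition mk_cone_at (s : forall i, Hom (ob_at i X) V)
    (c : forall i j, Hom i j -> mor (Hom (ob_at i X) V))
    (c_dom : forall i j (u : Hom i j), dom (c i j u) = s i)
    (c_cod : forall i j (u : Hom i j), cod (c i j u) = s j · nat_at u X)
    (c_inv : forall i j (u : Hom i j), invertible (c i j u))
    (c_id1 : forall i, c i i (id1 i) = idm (s i))
    (c_comp1 : forall i j k (v : Hom j k) (u : Hom i j),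
       c i k (v · u) = tc (c j k v ▷ nat_at u X) (c i j u))
    (c_nat : forall i j (a : mor (Hom i j)),
       c i j (cod a) = tc (s j ◁ modif_at a X) (c i j (dom a))) :
  PsCone (tf_comp (ev k D X) F) V :=
  @mk_cone I D (tf_comp (ev k D X) F) V s c c_dom c_cod c_inv c_id1 c_comp1 c_nat.

End Cone.

Section PointwiseColim.
Context {X : C} {W : D} {lam : PsCone (tf_comp (ev k D X) F) W} (H : IsPsColim lam) (V : D).

Lemma colim_at_ext1 (t t' : Hom W V) :
  (forall i, t · leg_at lam i = t' · leg_at lam i) ->
  (forall i j (u : Hom i j), t ◁ cell_at lam u = t' ◁ cell_at lam u) -> t = t'.
Proof. exact (@colim_ext1 _ _ _ _ _ H V t t'). Qed.

Lemma colim_at_ext2 (r r' : mor (Hom W V)) :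
  dom r = dom r' -> cod r = cod r' ->
  (forall i, r ▷ leg_at lam i = r' ▷ leg_at lam i) -> r = r'.
Proof. exact (@colim_ext2 _ _ _ _ _ H V r r'). Qed.

Lemma colim_at_desc1 (s : PsCone (tf_comp (ev k D X) F) V) :
  exists t : Hom W V, (forall i, t · leg_at lam i = leg_at s i) /\
    (forall i j (u : Hom i j), t ◁ cell_at lam u = cell_at s u).
Proof. exact (@colim_desc1 _ _ _ _ _ H V s). Qed.

Lemma colim_at_desc2 (t t' : Hom W V) (r : forall i, mor (Hom (ob_at i X) V)) :
  (forall i, dom (r i) = t · leg_at lam i) -> (forall i, cod (r i) = t' · leg_at lam i) ->
  (forall i j (u : Hom i j),
     tc (r j ▷ nat_at u X) (t ◁ cell_at lam u) = tc (t' ◁ cell_at lam u) (r i)) ->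
  exists q : mor (Hom W V), dom q = t /\ cod q = t' /\ forall i, q ▷ leg_at lam i = r i.
Proof. exact (@colim_desc2 _ _ _ _ _ H V t t' r). Qed.

Lemma colim_at_idm (q : mor (Hom W V)) :
  (forall i, q ▷ leg_at lam i = idm (dom q · leg_at lam i)) -> q = idm (dom q).
Proof. exact (@colim_idm _ _ _ _ _ H V q). Qed.

Lemma colim_at_invertible (q : mor (Hom W V)) :
  (forall i, invertible (q ▷ leg_at lam i)) -> invertible q.
Proof. exact (@colim_invertible _ _ _ _ _ H V q). Qed.

End PointwiseColim.
End Pointwise.

#[local] Hint Resolve cell_at_inv : core.

Ltac ends_step ::= first [ rewrite cell_at_dom | rewrite cell_at_cod
  | rewrite mdom_at | rewrite mcod_at | rewrite nat_at_comp1_leg ].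

(** * The 2-functor of pointwise pseudocolimits *)

Section Colimit2Functor.
Context {I C D : TwoCat} {k : kind} (F : TwoFunctor I (HOM k C D)) (L : C -> D).
Context (lam : forall X : C, PsCone (tf_comp (ev k D X) F) (L X)).

(** The second equation determines [t] on the cells because [pn2 (nat_at F u) f] is
    invertible.  Stated without the inverse it is stable under composition by plain pasting,
    and for 2-natural legs it is the modification law for the cells of [lam]. *)
Definition is_map1 {X Y : C} (f : Hom X Y) (t : Hom (L X) (L Y)) : Prop :=
  (forall i, t · leg_at (lam X) i = leg_at (lam Y) i · map1 (ob_at F i) f) /\
  (forall i j (u : Hom i j),
     tc (leg_at (lam Y) j ◁ pn2 (nat_at F u) f) (t ◁ cell_at (lam X) u)
     = cell_at (lam Y) u ▷ map1 (ob_at F i) f).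

Definition is_map2 {X Y : C} (a : mor (Hom X Y)) (r : mor (Hom (L X) (L Y))) : Prop :=
  is_map1 (dom a) (dom r) /\ is_map1 (cod a) (cod r) /\
  forall i, r ▷ leg_at (lam X) i = leg_at (lam Y) i ◁ map2 (ob_at F i) a.

(** This cone induces the value of the pointwise pseudocolimit on [f]. *)
Lemma map1_cone {X Y : C} (f : Hom X Y) :
  exists s : PsCone (tf_comp (ev k D X) F) (L Y),
    (forall i, leg_at s i = leg_at (lam Y) i · map1 (ob_at F i) f) /\
    (forall i j (u : Hom i j),
       tc (leg_at (lam Y) j ◁ pn2 (nat_at F u) f) (cell_at s u)
       = cell_at (lam Y) u ▷ map1 (ob_at F i) f).
Proof.
  set (n := fun i j (u : Hom i j) => leg_at (lam Y) j ◁ pn2 (nat_at F u) f).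
  set (m := fun i j (u : Hom i j) =>
              tc (inv (n i j u)) (cell_at (lam Y) u ▷ map1 (ob_at F i) f)).
  assert (n_inv : forall i j u, invertible (n i j u)) by (intros; unfold n; auto).
  assert (m_dom : forall i j u, dom (m i j u) = leg_at (lam Y) i · map1 (ob_at F i) f)
    by (intros; unfold m, n; ends).
  assert (m_cod : forall i j u,
            cod (m i j u) = leg_at (lam Y) j · map1 (ob_at F j) f · nat_at F u X)
    by (intros; unfold m, n; ends).
  assert (m_eq : forall i j u,
            tc (n i j u) (m i j u) = cell_at (lam Y) u ▷ map1 (ob_at F i) f).
  { intros; unfold m. rewrite tc_assoc by (unfold n; ends).
    rewrite tc_inv_r by auto. apply tc_idl. unfold n; ends. }
  unshelve eexists (@mk_cone_at _ _ _ _ F X (L Y)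
    (fun i => leg_at (lam Y) i · map1 (ob_at F i) f) m m_dom m_cod _ _ _ _).
  - intros; unfold m; apply invertible_tc; auto. unfold n; ends.
  - intro i. apply (cancel_l (n_inv i i (id1 i))); [unfold n; ends | |].
    + unfold n; ends. rewrite nat_at_id1; simpl; ends.
    + rewrite m_eq. unfold n; rewrite nat_at_id1; simpl.
      rewrite cell_at_id1, !comp2_idm, tc_idl by ends; reflexivity.
  (* The composition and 2-cell laws are checked after pasting with the invertible [n],
     where the inverse hidden in [m] disappears. *)
  - intros i j h v u. apply (cancel_l (n_inv i h (v · u))).
    + rewrite m_cod; unfold n; ends.
    + unfold n; ends; rewrite ?m_cod, ?m_dom; ends.
    + rewrite m_eq. unfold n. rewrite nat_at_comp1_cell, lw_tc by ends.
      rewrite cell_at_comp1, rw_tc by ends.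
      rewrite <- tc_assoc by (ends; rewrite ?m_cod, ?m_dom; ends).
      rewrite (@tc_assoc _ _ (m j h v ▷ nat_at F u X)) by (ends; rewrite ?m_cod, ?m_dom; ends).
      rewrite lw_rw, <- (@rw_tc _ _ _ _ _ (m j h v)) by (ends; rewrite ?m_cod, ?m_dom; ends).
      fold (n j h v). rewrite m_eq, !rw_rw, <- (m_eq i j u), lw_lw. unfold n.
      rewrite !tc_assoc by (ends; rewrite ?m_cod; ends).
      f_equal. apply interchange; ends.
  - intros i j a. apply (cancel_l (n_inv i j (cod a))).
    + rewrite m_cod; unfold n; ends.
    + unfold n; ends; rewrite ?m_cod, ?m_dom; ends.
    + rewrite m_eq, cell_at_nat, rw_tc, <- m_eq by ends. unfold n.
      rewrite !tc_assoc by (ends; rewrite ?m_cod, ?m_dom; ends).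
      rewrite <- !lw_lw, <- !lw_rw, <- !lw_tc by ends.
      rewrite modif_at_nat; reflexivity.
  - split; [reflexivity | exact m_eq].
Qed.

Context (H : forall X : C, IsPsColim (lam X)).

Lemma is_map1_exists {X Y : C} (f : Hom X Y) : exists t, is_map1 f t.
Proof.
  destruct (map1_cone f) as (s & s1 & s2).
  destruct (colim_at_desc1 (H X) s) as (t & t1 & t2).
  exists t; split; intros; rewrite ?t1, ?t2; auto.
Qed.

Lemma is_map1_unique {X Y : C} (f : Hom X Y) t t' : is_map1 f t -> is_map1 f t' -> t = t'.
Proof.
  intros [t1 t2] [t1' t2']. apply (colim_at_ext1 (H X)).
  - intro i; rewrite t1, t1'; reflexivity.
  - intros i j u.
    apply (@cancel_l _ (leg_at (lam Y) j ◁ pn2 (nat_at F u) f)); auto.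
    + ends.
    + ends.
    + rewrite t2, t2'; reflexivity.
Qed.

Lemma is_map1_id1 (X : C) : is_map1 (id1 X) (id1 (L X)).
Proof.
  split; [intros; ends |].
  intros i j u. rewrite pn2_id1, comp2_idm, comp2_idl, fmap_id1, comp2_idr. apply tc_idl; ends.
Qed.

Lemma is_map1_comp1 {X Y Z : C} (g : Hom Y Z) (f : Hom X Y) t s :
  is_map1 g t -> is_map1 f s -> is_map1 (g · f) (t · s).
Proof.
  intros [t1 t2] [s1 s2]; split.
  - intro i. rewrite <- comp1_assoc, s1, comp1_assoc, t1. ends.
  - intros i j u.
    rewrite pn2_comp1_tc, lw_tc, <- !lw_lw by ends.
    assert (e1 : dom (leg_at (lam Y) j ◁ pn2 (nat_at F u) f) = cod (s ◁ cell_at (lam X) u))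
      by (ends; rewrite s1; reflexivity).
    assert (e2 : dom (leg_at (lam Z) j ◁ pn2 (nat_at F u) g) = cod (t ◁ cell_at (lam Y) u))
      by (ends; rewrite t1; reflexivity).
    rewrite <- tc_assoc; [| ends | ends; rewrite <- t1, <- (comp1_assoc t s), s1; ends].
    rewrite (lw_lw (leg_at (lam Z) j)), <- t1, <- lw_lw, <- lw_tc, s2 by auto.
    rewrite !lw_rw, <- rw_tc, t2, rw_rw, fmap_comp1 by auto. reflexivity.
Qed.

(** Compatibility of the family [leg_at (lam Y) i ◁ map2 (ob_at F i) a] is naturality of
    [nat_at F u] with respect to [a], pasted with the equations that define the values on
    [dom a] and [cod a]. *)
Lemma is_map2_exists {X Y : C} (a : mor (Hom X Y)) : exists r, is_map2 a r.
Proof.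
  destruct (is_map1_exists (dom a)) as [t Ht], (is_map1_exists (cod a)) as [t' Ht'].
  pose proof Ht as [t1 t2]; pose proof Ht' as [t1' t2'].
  destruct (colim_at_desc2 (H X) (t := t) (t' := t')
              (r := fun i => leg_at (lam Y) i ◁ map2 (ob_at F i) a)) as (r & r1 & r2 & r3).
  - intro i; rewrite t1; ends.
  - intro i; rewrite t1'; ends.
  - intros i j u.
    apply (@cancel_l _ (leg_at (lam Y) j ◁ pn2 (nat_at F u) (cod a))); auto.
    + ends; rewrite t1; ends.
    + ends; rewrite t1'; ends.
    + rewrite !tc_assoc by (ends; rewrite ?t1, ?t1'; ends).
      rewrite t2', <- lw_rw, <- lw_tc, pn2_nat_tc, lw_tc by ends.
      rewrite <- tc_assoc, t2, lw_lw by (ends; rewrite ?t1; ends).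
      symmetry; apply interchange; ends.
  - exists r; unfold is_map2; rewrite r1, r2; auto.
Qed.

Lemma is_map2_unique {X Y : C} (a : mor (Hom X Y)) r r' :
  is_map2 a r -> is_map2 a r' -> r = r'.
Proof.
  intros (d & c & e) (d' & c' & e'). apply (colim_at_ext2 (H X)).
  - apply (is_map1_unique d d').
  - apply (is_map1_unique c c').
  - intro i; rewrite e, e'; reflexivity.
Qed.

Lemma is_map2_idm {X Y : C} (f : Hom X Y) t : is_map1 f t -> is_map2 (idm f) (idm t).
Proof.
  intro Ht. unfold is_map2. rewrite !dom_idm, !cod_idm. split; [|split]; auto.
  intro i. rewrite fidm, !comp2_idm. f_equal. apply Ht.
Qed.

(** Composability of [s] and [r] is a conclusion because the shared end is the value on the
    1-cell [dom b], which is unique. *)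
Lemma is_map2_tc {X Y : C} (b a : mor (Hom X Y)) s r :
  dom b = cod a -> is_map2 b s -> is_map2 a r -> dom s = cod r /\ is_map2 (tc b a) (tc s r).
Proof.
  intros e (ds & cs & es) (dr & cr & er).
  assert (e' : dom s = cod r) by (rewrite e in ds; apply (is_map1_unique ds cr)).
  split; auto. unfold is_map2.
  rewrite (dom_tc e), (cod_tc e), (dom_tc e'), (cod_tc e'). split; [|split]; auto.
  intro i. rewrite rw_tc, es, er, <- lw_tc, <- fmor_tc; ends.
Qed.

Lemma is_map2_comp2 {X Y Z : C} (b : mor (Hom Y Z)) (a : mor (Hom X Y)) s r :
  is_map2 b s -> is_map2 a r -> is_map2 (b ⋆ a) (s ⋆ r).
Proof.
  intros (ds & cs & es) (dr & cr & er). unfold is_map2.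
  rewrite !dom_comp2, !cod_comp2. split; [|split]; auto using is_map1_comp1.
  intro i. rewrite <- comp2_assoc, er, comp2_assoc, es, <- comp2_assoc, fmap_comp2.
  reflexivity.
Qed.

Lemma pointwise_colim_2functor :
  exists S : TwoFunctorStr L,
    (forall X Y (f : Hom X Y), is_map1 f (fmap S X Y f)) /\
    (forall X Y (a : mor (Hom X Y)), is_map2 a (fmor (fmap S X Y) a)).
Proof.
  pose (m1 := fun X Y (f : Hom X Y) =>
    proj1_sig (constructive_indefinite_description _ (is_map1_exists f))).
  assert (m1P : forall X Y (f : Hom X Y), is_map1 f (m1 X Y f)).
  { intros; unfold m1; destruct constructive_indefinite_description; auto. }
  pose (m2 := fun X Y (a : mor (Hom X Y)) =>
    proj1_sig (constructive_indefinite_description _ (is_map2_exists a))).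
  assert (m2P : forall X Y (a : mor (Hom X Y)), is_map2 a (m2 X Y a)).
  { intros; unfold m2; destruct constructive_indefinite_description; auto. }
  clearbody m1 m2.
  unshelve refine (let Fm := _ : forall X Y, Functor (Hom X Y) (Hom (L X) (L Y)) in _).
  { intros X Y. refine {| fob := m1 X Y; fmor := m2 X Y |}.
    - intro a. apply (is_map1_unique (f := dom a)); auto; apply (m2P _ _ a).
    - intro a. apply (is_map1_unique (f := cod a)); auto; apply (m2P _ _ a).
    - intro f. apply (is_map2_unique (a := idm f)); auto using is_map2_idm.
    - intros b a e e'. rewrite !cmp_tc. apply (is_map2_unique (a := tc b a)); auto.
      apply is_map2_tc; auto. }
  unshelve eexists {| fmap := Fm |}; simpl; auto.
  - intro X. apply (is_map1_unique (f := id1 X)); auto using is_map1_id1.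
  - intros X Y Z g f. apply (is_map1_unique (f := g · f)); auto using is_map1_comp1.
  - intros X Y Z b a. apply (is_map2_unique (a := b ⋆ a)); auto using is_map2_comp2.
Qed.

End Colimit2Functor.

(** * 1-cells and 2-cells between 2-functors *)

Definition hom1 {k} {C D : TwoCat} {G K : HOM k C D} (t : PsNat (G : TwoFunctor C D) K)
  (p : allowed k t) : Hom G K := exist _ t p.

Definition hom2 {k} {C D : TwoCat} {G K : HOM k C D} (r : Modif (G : TwoFunctor C D) K)
  (p : allowed k (mdom r)) (q : allowed k (mcod r)) : mor (Hom G K) := exist _ r (conj p q).

Section HomCells.
Context {k : kind} {C D : TwoCat} {G K : HOM k C D}.

Lemma nat_of_hom1 (t : PsNat (G : TwoFunctor C D) K) (p : allowed k t) : nat_of (hom1 p) = t.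
Proof. reflexivity. Qed.

Lemma nat_of_dom (r : mor (Hom G K)) : nat_of (dom r) = mdom (modif_of r).
Proof. reflexivity. Qed.

Lemma nat_of_cod (r : mor (Hom G K)) : nat_of (cod r) = mcod (modif_of r).
Proof. reflexivity. Qed.

Lemma modif_of_hom2 (r : Modif (G : TwoFunctor C D) K) p q :
  modif_of (@hom2 k C D G K r p q) = r.
Proof. reflexivity. Qed.

Lemma nat_of_comp1 {M : HOM k C D} (t : Hom K M) (s : Hom G K) :
  nat_of (t · s) = pcomp (nat_of t) (nat_of s).
Proof. reflexivity. Qed.

Lemma modif_of_comp2 {M : HOM k C D} (t : mor (Hom K M)) (s : mor (Hom G K)) :
  modif_of (t ⋆ s) = hmodif (modif_of t) (modif_of s).
Proof. reflexivity. Qed.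

Lemma modif_of_idm (t : Hom G K) :
  modif_of (idm t) = idmodif (nat_of t).
Proof. reflexivity. Qed.
Lemma hom_eq1 (t t' : Hom G K) : nat_of t = nat_of t' -> t = t'.
Proof. destruct t, t'; apply subset_eq_compat. Qed.

Lemma hom_eq2 (r r' : mor (Hom G K)) :
  dom r = dom r' -> cod r = cod r' -> (forall X, modif_of r X = modif_of r' X) -> r = r'.
Proof.
  intros d c e.
  assert (modif_of r = modif_of r').
  { apply Modif_eq; auto.
    - exact (f_equal nat_of d).
    - exact (f_equal nat_of c). }
  destruct r, r'; apply subset_eq_compat; auto.
Qed.

Lemma modif_of_tc (b a : mor (Hom G K)) X :
  dom b = cod a -> modif_of (tc b a) X = tc (modif_of b X) (modif_of a X).
Proof. intro e. exact (fmor_tc (ev_map G K X) e). Qed.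

Lemma dom_modif_of (r : mor (Hom G K)) X : dom (modif_of r X) = nat_of (dom r) X.
Proof. exact (mcell_dom (modif_of r) X). Qed.

Lemma cod_modif_of (r : mor (Hom G K)) X : cod (modif_of r X) = nat_of (cod r) X.
Proof. exact (mcell_cod (modif_of r) X). Qed.

Definition inv_modif (r : Modif (G : TwoFunctor C D) K) (H : forall X, invertible (r X)) :
  Modif (G : TwoFunctor C D) K.
Proof.
  refine {| mdom := mcod r; mcod := mdom r; mcell := fun X => inv (r X) |}.
  - intro X; ends.
  - intro X; ends.
  - intros X Y f e1 e2. rewrite !cmp_tc.
    apply (@cancel_l _ (r Y ▷ map1 (G : TwoFunctor C D) f)); auto; [ends | ends |].
    rewrite !tc_assoc by ends.
    rewrite <- rw_tc, tc_inv_r, comp2_idm, tc_idl by ends.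
    rewrite mcell_nat_tc, <- tc_assoc, <- lw_tc, tc_inv_r, comp2_idm, tc_idr by ends.
    reflexivity.
Defined.

Lemma hom_invertible (r : mor (Hom G K)) : (forall X, invertible (modif_of r X)) -> invertible r.
Proof.
  intro H. destruct r as [r [p1 p2]].
  set (b := exist _ (inv_modif H) (conj p2 p1) : mor (Hom G K)).
  assert (e1 : dom b = cod (exist _ r (conj p1 p2) : mor (Hom G K))) by (apply hom_eq1; reflexivity).
  assert (e2 : cod b = dom (exist _ r (conj p1 p2) : mor (Hom G K))) by (apply hom_eq1; reflexivity).
  apply invertible_intro with (b := b); auto.
  - apply hom_eq2; [ends | ends |]. intro X. rewrite modif_of_tc by auto.
    simpl. rewrite tc_inv_l by apply H. ends.
  - apply hom_eq2; [ends | ends |]. intro X. rewrite modif_of_tc by auto.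
    simpl. rewrite tc_inv_r by apply H. ends.
Qed.

End HomCells.

Lemma pcomp_strict {C D : TwoCat} {G K M : TwoFunctor C D} (t : PsNat K M) (s : PsNat G K)
    X Y (f : Hom X Y) :
  is_2natural s -> pn2 (pcomp t s) f = pn2 t f ▷ s X.
Proof.
  intro e. simpl. rewrite cmp_tc, e, comp2_idm. apply tc_idl; ends.
Qed.

(** * The pointwise cone is a pseudocolimit of 2-functors *)

Section HomColimit.
Context {I C D : TwoCat} {k : kind} {F : TwoFunctor I (HOM k C D)} {L : TwoFunctor C D}.
Context {lam : forall X : C, PsCone (tf_comp (ev k D X) F) (L X)}.
Context (L1 : forall X Y (f : Hom X Y), is_map1 lam f (map1 L f)).
Context (L2 : forall X Y (a : mor (Hom X Y)), is_map2 lam a (map2 L a)).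

Lemma map1_leg X Y (f : Hom X Y) i :
  map1 L f · leg_at (lam X) i = leg_at (lam Y) i · map1 (ob_at F i) f.
Proof. apply L1. Qed.

Lemma map1_cell X Y (f : Hom X Y) i j (u : Hom i j) :
  tc (leg_at (lam Y) j ◁ pn2 (nat_at F u) f) (map1 L f ◁ cell_at (lam X) u)
  = cell_at (lam Y) u ▷ map1 (ob_at F i) f.
Proof. apply L1. Qed.

Lemma map2_leg X Y (a : mor (Hom X Y)) i :
  map2 L a ▷ leg_at (lam X) i = leg_at (lam Y) i ◁ map2 (ob_at F i) a.
Proof. apply L2. Qed.

Definition leg_nat (i : I) : PsNat (ob_at F i) L.
Proof.
  refine {| pn1 := fun X => leg_at (lam X) i;
            pn2 := fun X Y f => idm (map1 L f · leg_at (lam X) i) |}.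
  - intros; ends.
  - intros; ends. apply map1_leg.
  - intros; apply invertible_idm.
  - intros; ends.
  - intros X Y Z g f e. rewrite cmp_tc, !comp2_idm, <- comp1_assoc, <- map1_leg.
    rewrite tc_idl; ends.
  - intros X Y a e1 e2. rewrite !cmp_tc, map2_leg, tc_idl, tc_idr; ends;
    rewrite map1_leg; auto.
Defined.

Lemma leg_nat_strict i : is_2natural (leg_nat i).
Proof. intros X Y f; reflexivity. Qed.

Definition cell_modif {i j : I} (u : Hom i j) : Modif (ob_at F i) L.
Proof.
  refine {| mdom := leg_nat i; mcod := pcomp (leg_nat j) (nat_at F u);
            mcell := fun X => cell_at (lam X) u |}.
  - intro; simpl; ends.
  - intro; simpl; ends.
  - intros X Y f e1 e2; simpl in *. rewrite !cmp_tc, comp2_idm.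
    rewrite <- tc_assoc, tc_idl, tc_idr, map1_cell; ends; rewrite map1_leg; ends.
Defined.

Definition leg_hom (i : I) : Hom (F i) (L : HOM k C D) :=
  @hom1 k C D (F i) L (leg_nat i) (fun _ => @leg_nat_strict i).

Definition cell_hom {i j : I} (u : Hom i j) : mor (Hom (F i) (L : HOM k C D)) :=
  @hom2 k C D (F i) L (cell_modif u) (fun _ => @leg_nat_strict i)
    (allowed_pcomp (t := leg_nat j) (s := nat_at F u) (fun _ => @leg_nat_strict j)
       (proj2_sig (map1 F u))).

Lemma nat_of_leg_hom i : nat_of (leg_hom i) = leg_nat i.
Proof. reflexivity. Qed.

Lemma modif_of_cell_hom i j (u : Hom i j) : modif_of (cell_hom u) = cell_modif u.
Proof. reflexivity. Qed.

Lemma dom_cell_hom i j (u : Hom i j) : dom (cell_hom u) = leg_hom i.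
Proof. apply hom_eq1; rewrite nat_of_dom, modif_of_cell_hom; reflexivity. Qed.

Lemma cod_cell_hom i j (u : Hom i j) : cod (cell_hom u) = leg_hom j · map1 F u.
Proof.
  apply hom_eq1; rewrite nat_of_cod, modif_of_cell_hom, nat_of_comp1; reflexivity.
Qed.

Definition colim_cone : PsCone F (L : HOM k C D).
Proof.
  refine (@mk_cone _ _ F (L : HOM k C D) leg_hom (@cell_hom) dom_cell_hom cod_cell_hom _ _ _ _).
  - intros; apply hom_invertible; intro X. exact (cell_at_inv (lam X) u).
  - intro i. apply hom_eq2.
    + rewrite dom_cell_hom, dom_idm; reflexivity.
    + rewrite cod_cell_hom, fmap_id1, comp1_idr, cod_idm; reflexivity.
    + intro X; exact (cell_at_id1 (lam X) i).
  - intros i j h v u.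
    assert (e : dom (cell_hom v ▷ map1 F u) = cod (cell_hom u))
      by (rewrite dom_comp2, dom_idm, dom_cell_hom, cod_cell_hom; reflexivity).
    apply hom_eq2.
    + rewrite dom_tc, !dom_cell_hom by auto; reflexivity.
    + rewrite cod_tc, cod_comp2, !cod_cell_hom, cod_idm, fmap_comp1, comp1_assoc by auto.
      reflexivity.
    + intro X. rewrite modif_of_tc by auto. exact (cell_at_comp1 (lam X) v u).
  - intros i j a.
    assert (e : dom (leg_hom j ◁ map2 F a) = cod (cell_hom (dom a)))
      by (rewrite dom_comp2, dom_idm, cod_cell_hom, fdom; reflexivity).
    apply hom_eq2.
    + rewrite dom_tc, !dom_cell_hom by auto; reflexivity.
    + rewrite cod_tc, cod_comp2, !cod_cell_hom, cod_idm, fcod by auto; reflexivity.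
    + intro X. rewrite modif_of_tc by auto. exact (cell_at_nat (lam X) a).
Defined.

Context (H : forall X : C, IsPsColim (lam X)).

Lemma leg_colim_cone i : leg colim_cone i = leg_hom i.
Proof. reflexivity. Qed.

(** As the legs are 2-natural, the structure cell of [t · leg colim_cone i] is that of [t]
    whiskered by the leg, so the structure cells of [t] are determined too. *)
Lemma colim_cone_ext1 (V : HOM k C D) (t t' : Hom (L : HOM k C D) V) :
  (forall i, t · leg colim_cone i = t' · leg colim_cone i) ->
  (forall i j (u : Hom i j), t ◁ cell colim_cone u = t' ◁ cell colim_cone u) -> t = t'.
Proof.
  intros e1 e2.
  assert (E1 : forall i, pcomp (nat_of t) (leg_nat i) = pcomp (nat_of t') (leg_nat i)).
  { intro i. pose proof (f_equal nat_of (e1 i)) as E.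
    rewrite !nat_of_comp1, leg_colim_cone, nat_of_leg_hom in E. exact E. }
  assert (T : forall X, nat_of t X = nat_of t' X).
  { intro X. apply (colim_at_ext1 (H X)).
    - intro i. exact (f_equal (fun z : PsNat _ _ => z X) (E1 i)).
    - intros i j u. exact (f_equal (fun z => modif_of z X) (e2 i j u)). }
  apply hom_eq1, PsNat_eq; auto.
  intros X Y f. apply (colim_at_ext2 (H X)).
  - ends.
  - ends.
  - intro i. pose proof (f_equal (fun z => pn2 z f) (E1 i)) as E. cbn beta in E.
    rewrite !pcomp_strict in E by apply leg_nat_strict. exact E.
Qed.

Lemma colim_cone_ext2 (V : HOM k C D) (r r' : mor (Hom (L : HOM k C D) V)) :
  dom r = dom r' -> cod r = cod r' ->
  (forall i, r ▷ leg colim_cone i = r' ▷ leg colim_cone i) -> r = r'.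
Proof.
  intros d c e. apply hom_eq2; auto. intro X. apply (colim_at_ext2 (H X)).
  - rewrite !dom_modif_of, d; auto.
  - rewrite !cod_modif_of, c; auto.
  - intro i. exact (f_equal (fun z => modif_of z X) (e i)).
Qed.

(** The components descend pointwise; the modification law of the result is checked on the
    legs, where it becomes the one of [r i]. *)
Lemma colim_cone_desc2 (V : HOM k C D) (t t' : Hom (L : HOM k C D) V)
    (r : forall i, mor (Hom (F i) V)) :
  (forall i, dom (r i) = t · leg colim_cone i) ->
  (forall i, cod (r i) = t' · leg colim_cone i) ->
  (forall i j (u : Hom i j),
     tc (r j ▷ map1 F u) (t ◁ cell colim_cone u) = tc (t' ◁ cell colim_cone u) (r i)) ->
  exists q : mor (Hom (L : HOM k C D) V),
    dom q = t /\ cod q = t' /\ forall i, q ▷ leg colim_cone i = r i.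
Proof.
  intros d c e.
  assert (dX : forall i X, dom (modif_of (r i) X) = nat_of t X · leg_at (lam X) i)
    by (intros; rewrite dom_modif_of, d; reflexivity).
  assert (cX : forall i X, cod (modif_of (r i) X) = nat_of t' X · leg_at (lam X) i)
    by (intros; rewrite cod_modif_of, c; reflexivity).
  assert (Q : forall X, exists q : mor (Hom (L X) ((V : TwoFunctor C D) X)),
            dom q = nat_of t X /\ cod q = nat_of t' X /\
            forall i, q ▷ leg_at (lam X) i = modif_of (r i) X).
  { intro X. apply (colim_at_desc2 (H X));
      [intro; apply dX | intro; apply cX |].
    intros i j u. pose proof (f_equal (fun z => modif_of z X) (e i j u)) as E. cbn beta in E.
    rewrite !modif_of_tc in E; [exact E | |]; ends; rewrite ?c, ?d;
      rewrite <- ?comp1_assoc, <- ?cell_cod; ends. }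
  set (q := fun X => proj1_sig (constructive_indefinite_description _ (Q X))).
  assert (q_dom : forall X, dom (q X) = nat_of t X)
    by (intro X; unfold q; destruct constructive_indefinite_description as [? [? ?]]; auto).
  assert (q_cod : forall X, cod (q X) = nat_of t' X)
    by (intro X; unfold q; destruct constructive_indefinite_description as [? [? [? ?]]]; auto).
  assert (q_leg : forall X i, q X ▷ leg_at (lam X) i = modif_of (r i) X)
    by (intro X; unfold q; destruct constructive_indefinite_description as [? [? [? ?]]]; auto).
  clearbody q.
  assert (q_nat : forall X Y (f : Hom X Y),
    tc (q Y ▷ map1 L f) (pn2 (nat_of t) f)
    = tc (pn2 (nat_of t') f) (map1 (V : TwoFunctor C D) f ◁ q X)).
  { intros X Y f.
    assert (e1 : dom (q Y ▷ map1 L f) = cod (pn2 (nat_of t) f)) by ends.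
    assert (e2 : dom (pn2 (nat_of t') f) = cod (map1 (V : TwoFunctor C D) f ◁ q X)) by ends.
    apply (colim_at_ext2 (H X)); [ends | ends |].
    intro i. rewrite !rw_tc by auto.
    rewrite rw_rw, map1_leg, <- rw_rw, q_leg, <- lw_rw, q_leg.
    change (leg_at (lam X) i) with (leg_nat i X).
    rewrite <- !(pcomp_strict _ _ (@leg_nat_strict i)).
    pose proof (mcell_nat_tc (modif_of (r i)) f) as E.
    rewrite <- nat_of_dom, <- nat_of_cod, d, c, !nat_of_comp1, leg_colim_cone, nat_of_leg_hom in E.
    exact E. }
  unshelve refine (let qm := {| mdom := nat_of t; mcod := nat_of t'; mcell := q |} :
                     Modif L (V : TwoFunctor C D) in _); auto.
  { intros; rewrite !cmp_tc; auto. }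
  exists (@hom2 k C D L V qm (proj2_sig t) (proj2_sig t')).
  assert (e1 : dom (@hom2 k C D L V qm (proj2_sig t) (proj2_sig t')) = t)
    by (apply hom_eq1; rewrite nat_of_dom, modif_of_hom2; reflexivity).
  assert (e2 : cod (@hom2 k C D L V qm (proj2_sig t) (proj2_sig t')) = t')
    by (apply hom_eq1; rewrite nat_of_cod, modif_of_hom2; reflexivity).
  split; [|split]; auto.
  intro i; apply hom_eq2.
  - rewrite d, dom_comp2, e1, dom_idm; reflexivity.
  - rewrite c, cod_comp2, e2, cod_idm; reflexivity.
  - intro X. apply q_leg.
Qed.

(** Components and structure cells are both induced pointwise, and the pseudonaturality laws
    follow from those of the legs of [s] by uniqueness. *)
Lemma colim_cone_desc1 (V : HOM k C D) (s : PsCone F V) :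
  exists t : Hom (L : HOM k C D) V, (forall i, t · leg colim_cone i = leg s i) /\
    (forall i j (u : Hom i j), t ◁ cell colim_cone u = cell s u).
Proof.
  pose (v := fun i => nat_of (leg s i) : PsNat (ob_at F i) V).
  pose (w := fun i j (u : Hom i j) => modif_of (cell s u) : Modif (ob_at F i) V).
  assert (w_mdom : forall i j (u : Hom i j), mdom (w i j u) = v i).
  { intros. change (nat_of (dom (cell s u)) = v i). rewrite cell_dom; reflexivity. }
  assert (w_mcod : forall i j (u : Hom i j), mcod (w i j u) = pcomp (v j) (nat_at F u)).
  { intros. change (nat_of (cod (cell s u)) = pcomp (v j) (nat_at F u)).
    rewrite cell_cod; reflexivity. }
  (* The modification law for the cells of [s], with the structure cell of
     [pcomp (v j) (nat_at F u)] expanded. *)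
  assert (w_nat : forall i j (u : Hom i j) X Y (f : Hom X Y),
    tc (w i j u Y ▷ map1 (ob_at F i) f) (pn2 (v i) f)
    = tc (v j Y ◁ pn2 (nat_at F u) f)
        (tc (pn2 (v j) f ▷ nat_at F u X) (map1 (V : TwoFunctor C D) f ◁ w i j u X))).
  { intros. rewrite <- (w_mdom i j u), mcell_nat_tc, w_mcod.
    simpl; rewrite cmp_tc, tc_assoc; ends. rewrite w_mcod; simpl; ends. }
  assert (T : forall X, exists t : Hom (L X) ((V : TwoFunctor C D) X),
    (forall i, t · leg_at (lam X) i = v i X) /\
    (forall i j (u : Hom i j), t ◁ cell_at (lam X) u = w i j u X)).
  { intro X. exact (colim_at_desc1 (H X) (image_cone (ev k D X) s)). }
  set (t := fun X => proj1_sig (constructive_indefinite_description _ (T X))).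
  assert (t_leg : forall X i, t X · leg_at (lam X) i = v i X)
    by (intro X; unfold t; destruct constructive_indefinite_description as [? [? ?]]; auto).
  assert (t_cell : forall X i j (u : Hom i j), t X ◁ cell_at (lam X) u = w i j u X)
    by (intro X; unfold t; destruct constructive_indefinite_description as [? [? ?]]; auto).
  clearbody t.
  assert (Q : forall X Y (f : Hom X Y),
    exists q : mor (Hom (L X) ((V : TwoFunctor C D) Y)),
      dom q = map1 (V : TwoFunctor C D) f · t X /\ cod q = t Y · map1 L f /\
      forall i, q ▷ leg_at (lam X) i = pn2 (v i) f).
  { intros X Y f.
    assert (cods : forall i, t Y · map1 L f · leg_at (lam X) i = v i Y · map1 (ob_at F i) f).
    { intro; rewrite <- comp1_assoc, map1_leg, comp1_assoc, t_leg; auto. }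
    apply (colim_at_desc2 (H X)).
    - intro i; ends. rewrite <- comp1_assoc, t_leg; auto.
    - intro i; ends. 
    - intros i j u. rewrite <- lw_lw, t_cell.
      assert (e1 : dom (pn2 (v j) f ▷ nat_at F u X)
                   = cod (map1 (V : TwoFunctor C D) f ◁ w i j u X))
        by (ends; rewrite w_mcod; simpl; ends).
      assert (e2 : dom (t Y · map1 L f ◁ cell_at (lam X) u) = cod (pn2 (v i) f))
        by (ends; rewrite cods; ends).
      apply (@cancel_l _ (v j Y ◁ pn2 (nat_at F u) f)); auto.
      + rewrite cod_tc by auto. ends.
      + rewrite cod_tc by auto. ends.
      + rewrite <- w_nat, <- t_cell, <- t_leg, tc_assoc by (ends; rewrite ?cods; ends).
        rewrite <- !lw_lw, <- lw_tc, map1_cell, lw_rw; auto.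
        ends; rewrite map1_leg; ends. }
  set (q := fun X Y f => proj1_sig (constructive_indefinite_description _ (Q X Y f))).
  assert (q_dom : forall X Y f, dom (q X Y f) = map1 (V : TwoFunctor C D) f · t X)
    by (intros; unfold q; destruct constructive_indefinite_description as [? [? ?]]; auto).
  assert (q_cod : forall X Y f, cod (q X Y f) = t Y · map1 L f)
    by (intros; unfold q; destruct constructive_indefinite_description as [? [? [? ?]]]; auto).
  assert (q_leg : forall X Y f i, q X Y f ▷ leg_at (lam X) i = pn2 (v i) f)
    by (intros X Y f; unfold q;
        destruct constructive_indefinite_description as [? [? [? ?]]]; auto).
  clearbody q.
  unshelve refine (let tn := {| pn1 := t; pn2 := q |} : PsNat L (V : TwoFunctor C D) in _); auto.
  - intros X Y f. apply (colim_at_invertible (H X)). intro i. rewrite q_leg. auto.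
  - intro X. apply (colim_at_ext2 (H X)); [rewrite q_dom; ends | rewrite q_cod; ends |].
    intro i. rewrite q_leg, pn2_id1, comp2_idm, t_leg. reflexivity.
  - intros X Y Z g f e. rewrite cmp_tc in *.
    apply (colim_at_ext2 (H X)).
    + rewrite dom_tc by auto. ends; rewrite !q_dom; ends.
    + rewrite cod_tc by auto. ends; rewrite !q_cod; ends.
    + intro i. rewrite rw_tc, rw_rw, map1_leg, <- rw_rw, <- lw_rw, !q_leg, pn2_comp1_tc by auto.
      reflexivity.
  - intros X Y a e1 e2. rewrite !cmp_tc.
    apply (colim_at_ext2 (H X)).
    + rewrite !dom_tc by auto. ends; rewrite !q_dom; ends.
    + rewrite !cod_tc by auto. ends; rewrite !q_cod; ends.
    + intro i. rewrite !rw_tc, <- (lw_rw (t Y)), map2_leg, lw_lw, rw_rw, !q_leg, !t_leg by auto.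
      apply pn2_nat_tc.
  - assert (tn_ok : allowed k tn).
    (* For strict 1-cells the [q] restrict to identities along the legs. *)
    { intros ek X Y f. simpl. rewrite <- q_dom. apply (colim_at_idm (H X)).
      intro i. rewrite q_leg, q_dom, <- comp1_assoc, t_leg.
      apply (proj2_sig (leg s i) ek). }
    assert (tn_leg : forall i, hom1 tn_ok · leg colim_cone i = leg s i).
    { intro i. apply hom_eq1, PsNat_eq.
      - intro X. apply t_leg.
      - intros X Y f. etransitivity; [apply pcomp_strict, leg_nat_strict | apply q_leg]. }
    exists (hom1 tn_ok). split; auto.
    intros i j u. apply hom_eq2.
    + ends.
    + ends.
    + intro X. apply t_cell.
Qed.

Lemma colim_cone_colim : IsPsColim colim_cone.
Proof.
  apply colim_intro; [exact colim_cone_ext1 | exact colim_cone_ext2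
    | exact colim_cone_desc1 | exact colim_cone_desc2].
Qed.

End HomColimit.

Theorem hom_pointwise_colim (C D I : TwoCat) (k : kind) (F : TwoFunctor I (HOM k C D)) (L : C -> D)
    (lam : forall X : C, PsCone (tf_comp (ev k D X) F) (L X)) :
  (forall X : C, IsPsColim (lam X)) ->
  exists (SL : TwoFunctorStr L)
         (Lam : PsCone F (MkTwoFunctor L SL : HOM k C D)),
    (forall i : I, is_2natural (nat_of (pn1 Lam i))) /\
    (forall (i : I) (X : C), nat_of (pn1 Lam i) X = pn1 (lam X) i) /\
    (forall (i j : I) (u : Hom i j) (X : C), modif_of (pn2 Lam u) X = pn2 (lam X) u) /\
    IsPsColim Lam.
Proof.
  intro H. destruct (pointwise_colim_2functor H) as (S & S1 & S2).
  exists S, (@colim_cone _ _ _ _ F (MkTwoFunctor L S) lam S1 S2).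
  split; [|split; [|split]].
  - intros i X Y f; reflexivity.
  - reflexivity.
  - reflexivity.
  - apply colim_cone_colim; exact H.
Qed.

(** * Reversing 1-cells *)

Section Opposite.
Context {C D : TwoCat}.

Definition op_str {L : C -> D} (S : TwoFunctorStr L) : @TwoFunctorStr (op C) (op D) L.
Proof.
  refine {| fmap := fun X Y : op C => (fmap S Y X :
              Functor (@Hom (op C) X Y) (@Hom (op D) (L X) (L Y))) |}.
  - intro X; exact (fmap_id1 S X).
  - intros X Y Z g f; exact (fmap_comp1 S f g).
  - intros X Y Z b a; exact (fmap_comp2 S a b).
Defined.

Lemma op_str_onto {L : C -> D} (S : @TwoFunctorStr (op C) (op D) L) :
  exists S' : TwoFunctorStr L, op_str S' = S.
Proof.
  destruct S as [m m_id m_comp1 m_comp2].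
  unshelve eexists {| fmap := fun X Y : C => (m Y X : Functor (Hom X Y) (Hom (L X) (L Y))) |}.
  - intro X; exact (m_id X).
  - intros X Y Z g f; exact (m_comp1 Z Y X f g).
  - intros X Y Z b a; exact (m_comp2 Z Y X a b).
  - unfold op_str; f_equal; apply proof_irrelevance.
Qed.

Definition op_fun (F : TwoFunctor C D) : TwoFunctor (op C) (op D) :=
  @MkTwoFunctor (op C) (op D) F (op_str (tstr F)).

(** In [op D] a structure cell must go from [t X · map1 G f] to [map1 F f · t Y], against
    the direction of [pn2 t f]: hence the inverse. *)
Definition op_nat {F G : TwoFunctor C D} (t : PsNat G F) : PsNat (op_fun F) (op_fun G).
Proof.
  refine (@Build_PsNat (op C) (op D) (op_fun F) (op_fun G) (fun X => t X)
            (fun X Y (f : @Hom C Y X) => inv (pn2 t f)) _ _ _ _ _ _).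
  - intros X Y f; exact (eq_trans (dom_inv (pn2_inv t f)) (pn2_cod t f)).
  - intros X Y f; exact (eq_trans (cod_inv (pn2_inv t f)) (pn2_dom t f)).
  - intros X Y f; exact (invertible_inv (pn2_inv t f)).
  - intros X. exact (eq_trans (f_equal inv (pn2_id1 t X)) (inv_idm _)).
  - intros X Y Z g f e. simpl in *. rewrite cmp_tc.
    rewrite pn2_comp1_tc, inv_tc, !inv_comp2, !inv_idm; auto. ends.
  - intros X Y a e1 e2. simpl in *. rewrite !cmp_tc.
    apply (@cancel_l _ (pn2 t (cod a))); auto; [ends | ends |].
    rewrite !tc_assoc by ends. rewrite tc_inv_r, tc_idl, pn2_nat_tc by ends.
    rewrite <- tc_assoc, tc_inv_r, tc_idr by ends. reflexivity.
Defined.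

Definition op_modif {F G : TwoFunctor C D} (r : Modif G F) : Modif (op_fun F) (op_fun G).
Proof.
  refine (@Build_Modif (op C) (op D) (op_fun F) (op_fun G) (op_nat (mdom r)) (op_nat (mcod r))
            (fun X => mcell r X) _ _ _).
  - exact (mcell_dom r).
  - exact (mcell_cod r).
  - intros X Y f e1 e2. simpl in *. rewrite !cmp_tc.
    apply (@cancel_l _ (pn2 (mcod r) f)); auto; [ends | ends |].
    rewrite !tc_assoc by ends. rewrite tc_inv_r, tc_idl, <- mcell_nat_tc by ends.
    rewrite <- tc_assoc, tc_inv_r, tc_idr by ends. reflexivity.
Defined.

Lemma op_nat_allowed k {F G : TwoFunctor C D} (t : PsNat G F) :
  allowed k t -> allowed k (op_nat t).
Proof.
  intros H ek X Y f; specialize (H ek Y X f). simpl.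
  rewrite H, inv_idm, <- (pn2_cod t f), H, cod_idm. reflexivity.
Qed.

Lemma op_nat_strict_inv {F G : TwoFunctor C D} (t : PsNat G F) :
  is_2natural (op_nat t) -> is_2natural t.
Proof.
  intros H X Y f.
  assert (e : inv (pn2 t f) = idm (t Y · map1 G f)) by exact (H Y X f).
  rewrite <- (inv_inv (pn2_inv t f)), e, inv_idm, <- (pn2_dom t f).
  f_equal. rewrite <- (cod_inv (pn2_inv t f)), e. ends.
Qed.

Lemma op_nat_pid (F : TwoFunctor C D) : op_nat (pid F) = pid (op_fun F).
Proof. apply PsNat_eq; [reflexivity | intros X Y f; apply inv_idm]. Qed.

Lemma op_nat_pcomp {F G K : TwoFunctor C D} (t : PsNat G F) (s : PsNat K G) :
  op_nat (pcomp t s) = pcomp (op_nat s) (op_nat t).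
Proof.
  apply PsNat_eq; [reflexivity |]. intros X Y f. simpl.
  rewrite !cmp_tc, inv_tc, !inv_comp2, !inv_idm; auto. ends.
Qed.

Lemma op_nat_inj {F G : TwoFunctor C D} (t t' : PsNat G F) : op_nat t = op_nat t' -> t = t'.
Proof.
  intro e. apply PsNat_eq.
  - intro X. exact (f_equal (fun z : PsNat (op_fun F) (op_fun G) => pn1 z X) e).
  - intros X Y f. rewrite <- (inv_inv (pn2_inv t f)), <- (inv_inv (pn2_inv t' f)).
    f_equal. exact (f_equal (fun z : PsNat (op_fun F) (op_fun G) => @pn2 _ _ _ _ z Y X f) e).
Qed.

End Opposite.

(* [op (op C)] has the same computed operations as [C], so the laws of a transformation
   reversed twice serve as they stand for one between the original 2-functors. *)

Section Unopposite.
Context {C D : TwoCat} {F G : TwoFunctor C D}.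

Definition unop_nat (t : PsNat (op_fun F) (op_fun G)) : PsNat G F :=
  let s := op_nat t in
  @Build_PsNat C D G F (fun X => pn1 s X) (fun X Y f => @pn2 _ _ _ _ s X Y f)
    (pn2_dom s) (pn2_cod s) (pn2_inv s) (pn2_id1 s) (@pn2_comp1 _ _ _ _ s) (@pn2_nat _ _ _ _ s).

Lemma op_unop_nat (t : PsNat (op_fun F) (op_fun G)) : op_nat (unop_nat t) = t.
Proof.
  apply PsNat_eq; [reflexivity |]. intros X Y f. exact (inv_inv (pn2_inv t f)).
Qed.

Lemma unop_nat_allowed k (t : PsNat (op_fun F) (op_fun G)) :
  allowed k t -> allowed k (unop_nat t).
Proof. intro H. exact (op_nat_allowed H). Qed.

Definition unop_modif (r : Modif (op_fun F) (op_fun G)) : Modif G F :=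
  let s := op_modif r in
  @Build_Modif C D G F (unop_nat (mdom r)) (unop_nat (mcod r)) (fun X => mcell s X)
    (mcell_dom s) (mcell_cod s) (@mcell_nat _ _ _ _ s).

End Unopposite.

Section OpHom.
Context {k : kind} {C D : TwoCat}.

Section Hom.
Context {F G : TwoFunctor C D}.

Definition op_hom1 (t : @Hom (HOM k C D) G F) : @Hom (HOM k (op C) (op D)) (op_fun F) (op_fun G) :=
  @hom1 k (op C) (op D) (op_fun F) (op_fun G) (op_nat (nat_of t)) (op_nat_allowed (proj2_sig t)).

Definition op_hom2 (r : mor (@Hom (HOM k C D) G F)) :
    mor (@Hom (HOM k (op C) (op D)) (op_fun F) (op_fun G)) :=
  @hom2 k (op C) (op D) (op_fun F) (op_fun G) (op_modif (modif_of r))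
    (op_nat_allowed (proj1 (proj2_sig r))) (op_nat_allowed (proj2 (proj2_sig r))).

Lemma nat_of_op_hom1 t : nat_of (op_hom1 t) = op_nat (nat_of t).
Proof. reflexivity. Qed.

Lemma modif_of_op_hom2 r : modif_of (op_hom2 r) = op_modif (modif_of r).
Proof. reflexivity. Qed.

Lemma dom_op_hom2 r : dom (op_hom2 r) = op_hom1 (dom r).
Proof.
  apply hom_eq1. rewrite nat_of_dom, modif_of_op_hom2, nat_of_op_hom1, nat_of_dom. reflexivity.
Qed.

Lemma cod_op_hom2 r : cod (op_hom2 r) = op_hom1 (cod r).
Proof.
  apply hom_eq1. rewrite nat_of_cod, modif_of_op_hom2, nat_of_op_hom1, nat_of_cod. reflexivity.
Qed.

Lemma op_hom1_inj t t' : op_hom1 t = op_hom1 t' -> t = t'.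
Proof.
  intro e. apply hom_eq1, op_nat_inj. rewrite <- !nat_of_op_hom1, e. reflexivity.
Qed.

Definition op_hom_map : Functor (@Hom (op (HOM k C D)) F G)
    (@Hom (HOM k (op C) (op D)) (op_fun F) (op_fun G)).
Proof.
  refine (@Build_Functor (@Hom (HOM k C D) G F) _ op_hom1 op_hom2 dom_op_hom2 cod_op_hom2 _ _).
  - intro t; apply hom_eq2.
    + rewrite dom_op_hom2, !dom_idm; reflexivity.
    + rewrite cod_op_hom2, !cod_idm; reflexivity.
    + intro X. rewrite modif_of_op_hom2, (@modif_of_idm k (op C) (op D) (op_fun F) (op_fun G)).
      change (mcell (modif_of (@idm (@Hom (HOM k C D) G F) t)) X
              = idm (nat_of (op_hom1 t) X)).
      rewrite (@modif_of_idm k C D G F). reflexivity.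
  - intros b a e e'; apply hom_eq2.
    + rewrite dom_op_hom2, !dom_cmp, dom_op_hom2; reflexivity.
    + rewrite cod_op_hom2, !cod_cmp, cod_op_hom2; reflexivity.
    + intro X. rewrite modif_of_op_hom2, !cmp_tc.
      rewrite (modif_of_tc (G := op_fun F)) by auto.
      exact (@modif_of_tc k C D G F b a X e).
Defined.

Lemma op_hom_map_iso : IsIsoCat op_hom_map.
Proof.
  apply iso_cat_arrows. intros r.
  set (r0 := @hom2 k C D G F (unop_modif (modif_of r))
         (unop_nat_allowed (proj1 (proj2_sig r))) (unop_nat_allowed (proj2 (proj2_sig r)))).
  change (exists! a, op_hom2 a = r). exists r0.
  assert (e : op_hom2 r0 = r).
  { apply hom_eq2.
    - apply hom_eq1. rewrite !nat_of_dom, modif_of_op_hom2. apply op_unop_nat.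
    - apply hom_eq1. rewrite !nat_of_cod, modif_of_op_hom2. apply op_unop_nat.
    - reflexivity. }
  split; auto. intros r' e'. apply hom_eq2.
  - apply op_hom1_inj. rewrite <- !dom_op_hom2, e, e'; reflexivity.
  - apply op_hom1_inj. rewrite <- !cod_op_hom2, e, e'; reflexivity.
  - intro X. exact (f_equal (fun z : mor (@Hom (HOM k (op C) (op D)) (op_fun F) (op_fun G)) =>
      mcell (modif_of z) X) (eq_trans e (eq_sym e'))).
Qed.

End Hom.

Definition op_hom : TwoFunctor (op (HOM k C D)) (HOM k (op C) (op D)).
Proof.
  refine (@MkTwoFunctor (op (HOM k C D)) (HOM k (op C) (op D))
            (fun F : TwoFunctor C D => op_fun F)
            (@Build_TwoFunctorStr (op (HOM k C D)) (HOM k (op C) (op D))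
               (fun F : TwoFunctor C D => op_fun F)
               (fun F G : TwoFunctor C D => @op_hom_map F G) _ _ _)).
  - intro F. change (@op_hom1 F F (id1 (F : HOM k C D)) = id1 (op_fun F : HOM k (op C) (op D))).
    apply hom_eq1; rewrite nat_of_op_hom1. apply op_nat_pid.
  - intros F G K t s.
    change (op_hom1 (@comp1 (HOM k C D) K G F s t)
            = @comp1 (HOM k (op C) (op D)) (op_fun F) (op_fun G) (op_fun K)
                (op_hom1 t) (op_hom1 s)).
    apply hom_eq1. rewrite nat_of_comp1, !nat_of_op_hom1, nat_of_comp1. apply op_nat_pcomp.
  - intros F G K b a.
    change (op_hom2 (@comp2 (HOM k C D) K G F a b)
            = @comp2 (HOM k (op C) (op D)) (op_fun F) (op_fun G) (op_fun K)
                (op_hom2 b) (op_hom2 a)).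
    apply hom_eq2.
    + rewrite dom_comp2, !dom_op_hom2, dom_comp2.
      apply hom_eq1. rewrite nat_of_comp1, !nat_of_op_hom1, nat_of_comp1. apply op_nat_pcomp.
    + rewrite cod_comp2, !cod_op_hom2, cod_comp2.
      apply hom_eq1. rewrite nat_of_comp1, !nat_of_op_hom1, nat_of_comp1. apply op_nat_pcomp.
    + intro X. reflexivity.
Defined.

Lemma op_hom_iso (F G : op (HOM k C D)) : IsIsoCat (fmap (tstr op_hom) F G).
Proof. exact (@op_hom_map_iso F G). Qed.

End OpHom.

(** * Pseudolimits *)

(** Dualising before or after evaluation at [X] gives 2-functors with the same values and
    different proofs of the laws, so cones over one are cones over the other. *)
Section DualEvaluation.
Context {I C D : TwoCat} {k : kind} (F : TwoFunctor (op I) (HOM k C D)) (X : C).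

Definition dual_pointwise : TwoFunctor I (op D) := dual (tf_comp (ev k D X) F).

Definition pointwise_dual : TwoFunctor I (op D) :=
  tf_comp (ev k (op D) (X : op C)) (tf_comp op_hom (dual F)).

Lemma map1_dual_eq {i j : I} (u : Hom i j) : map1 dual_pointwise u = map1 pointwise_dual u.
Proof. transitivity (nat_of (map1 F u) X); reflexivity. Qed.

Lemma map2_dual_eq {i j : I} (a : mor (Hom i j)) : map2 dual_pointwise a = map2 pointwise_dual a.
Proof. transitivity (mcell (modif_of (map2 F a)) X); reflexivity. Qed.

Definition to_pointwise_dual {V : op D} (s : PsCone dual_pointwise V) : PsCone pointwise_dual V.
Proof.
  refine (@mk_cone I (op D) pointwise_dual V (leg s) (@cell _ _ _ _ s) (cell_dom s) _
            (cell_inv s) (cell_id1 s) _ _); intros.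
  - exact (eq_trans (cell_cod s u) (f_equal (fun z => leg s j · z) (map1_dual_eq u))).
  - exact (eq_trans (cell_comp1 s v u)
             (f_equal (fun z => tc (cell s v ▷ z) (cell s u)) (map1_dual_eq u))).
  - exact (eq_trans (cell_nat s a)
             (f_equal (fun z => tc (leg s j ◁ z) (cell s (dom a))) (map2_dual_eq a))).
Defined.

Definition of_pointwise_dual {V : op D} (s : PsCone pointwise_dual V) : PsCone dual_pointwise V.
Proof.
  refine (@mk_cone I (op D) dual_pointwise V (leg s) (@cell _ _ _ _ s) (cell_dom s) _
            (cell_inv s) (cell_id1 s) _ _); intros.
  - exact (eq_trans (cell_cod s u) (f_equal (fun z => leg s j · z) (eq_sym (map1_dual_eq u)))).
  - exact (eq_trans (cell_comp1 s v u)
             (f_equal (fun z => tc (cell s v ▷ z) (cell s u)) (eq_sym (map1_dual_eq u)))).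
  - exact (eq_trans (cell_nat s a)
             (f_equal (fun z => tc (leg s j ◁ z) (cell s (dom a))) (eq_sym (map2_dual_eq a)))).
Defined.

Lemma to_pointwise_dual_colim {V : op D} (s : PsCone dual_pointwise V) :
  IsPsColim s -> IsPsColim (to_pointwise_dual s).
Proof.
  intro H. apply colim_intro.
  - exact (@colim_ext1 _ _ _ _ _ H).
  - exact (@colim_ext2 _ _ _ _ _ H).
  - intros W s'. exact (colim_desc1 H (of_pointwise_dual s')).
  - intros W t t' r d c e. apply (colim_desc2 H d c).
    intros i j u.
    exact (eq_trans (f_equal (fun z => tc (r j ▷ z) (t ◁ cell s u)) (map1_dual_eq u)) (e i j u)).
Qed.

End DualEvaluation.

Theorem proposition1p2p4 (C D I : TwoCat) (k : kind) :
  (forall (F : TwoFunctor I (HOM k C D)) (L : C -> D)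
          (lam : forall X : C, PsCone (tf_comp (ev k D X) F) (L X)),
     (forall X : C, IsPsColim (lam X)) ->
     exists (SL : TwoFunctorStr L)
            (Lam : PsCone F (MkTwoFunctor L SL : HOM k C D)),
       (forall i : I, is_2natural (nat_of (pn1 Lam i))) /\
       (forall (i : I) (X : C), nat_of (pn1 Lam i) X = pn1 (lam X) i) /\
       (forall (i j : I) (u : Hom i j) (X : C),
          modif_of (pn2 Lam u) X = pn2 (lam X) u) /\
       IsPsColim Lam)
  /\
  (forall (F : TwoFunctor (op I) (HOM k C D)) (L : C -> D)
          (pi : forall X : C, PsLimCone (tf_comp (ev k D X) F) (L X)),
     (forall X : C, IsPsLim (pi X)) ->
     exists (SL : TwoFunctorStr L)
            (Pi : PsLimCone F (MkTwoFunctor L SL : HOM k C D)),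
       (forall i : I, is_2natural (nat_of (lim_proj Pi i))) /\
       (forall (i : I) (X : C), nat_of (lim_proj Pi i) X = lim_proj (pi X) i) /\
       (forall (i j : I) (u : Hom i j) (X : C),
          modif_of (lim_cell Pi u) X = lim_cell (pi X) u) /\
       IsPsLim Pi).
Proof.
  split.
  - intros F L lam H. exact (hom_pointwise_colim H).
  - intros F L pi H.
    destruct (@hom_pointwise_colim (op C) (op D) I k (tf_comp op_hom (dual F)) L
      (fun X => to_pointwise_dual (pi X)) (fun X => to_pointwise_dual_colim (H X)))
      as (S' & Lam & L_nat & L_leg & L_cell & L_colim).
    destruct (op_str_onto S') as [S <-].
    destruct (lift_cone op_hom_iso (V := (MkTwoFunctor L S : op (HOM k C D))) Lam) as [Pi e].
    exists S, Pi.
    subst Lam.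
    split; [|split; [|split]].
    + intro i. apply op_nat_strict_inv. exact (L_nat i).
    + intros i X. exact (L_leg i X).
    + intros i j u X. exact (L_cell i j u X).
    + exact (@colim_reflect _ _ _ op_hom (dual F) op_hom_iso _ Pi L_colim).
Qed.
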